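(* The group $G_f(X)$ is the semidirect product of the normal subgroup $\exp(\mathcal{N})\subset\widehat{\mathcal{C}}_f$ and $G_f(X^2)$. Moreover, $\exp(\mathcal{N})$ is the minimal normal closed subgroup of $G_f(X)$ containing the elements $\exp(c_is_it^i)$ for all $i\ge3$ and all $c_i\in\mathbb{C}$.
   Context: Algebra. Let $\mathbb{C}\langle X_1,X_2,\dots\rangle$ be the associative algebra with unit $I$ of complex noncommutative polynomials in free noncommuting variables $X_1,X_2,\dots$. Let $\mathcal{A}\subset\mathbb{C}\langle X_1,X_2,\dots\rangle[[t]]$ be the subalgebra of formal power series of the form $f=c_0I+\sum_{n\ge1}\big(\sum_{i_1+\cdots+i_k=n}c_{i_1,\dots,i_k}X_{i_1}\cdots X_{i_k}\big)t^n$ with complex coefficients (inner sum over all $k\ge1$ and all $(i_1,\dots,i_k)\in\mathbb{N}^k$ with sum $n$). Equip $\mathcal{A}$ with the weakest topology making all coefficient functions continuous. Let $G\subset\mathcal{A}$ be the topological group (under multiplication) of elements with $c_0=1$, and $\mathcal{L}_G\subset\mathcal{A}$ the Lie algebra of elements with $c_0=0$, with $[f,g]=fg-gf$; $\exp:\mathcal{L}_G\to G$, $\exp(f)=\sum_{n\ge0}f^n/n!$. $\mathcal{L}_{Lie}\subset\mathcal{L}_G$ is the closed Lie subalgebra of Lie elements, i.e. of $g=\sum_{n\ge1}g_nt^n\in\mathcal{L}_G$ with each $g_n$ in the free Lie algebra generated by $X_1,\dots,X_n$. The ideal $\mathcal{N}$. Put $s_i:=X_i-\frac{1}{i-2}[X_{i-1},X_1]$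 for $i\ge3$. $\mathcal{N}$ is the minimal normal closed Lie subalgebra (i.e. minimal closed Lie ideal) of $\mathcal{L}_{Lie}$ containing the elements $s_it^i$, $i\ge3$. Paths. Fix $T>0$, $I_T=[0,T]$. $X$ is the set of sequences $a=(a_1,a_2,\dots)$ of complex-valued functions $a_i\in L^\infty(I_T)$ with $\sup_{x\in I_T,\,i\in\mathbb{N}}|a_i(x)|^{1/i}<\infty$; $X^2$ is the subset with $a_i=0$ for all $i>2$. For $a\in X$ let $F_a:I_T\to G$ be the solution (by Picard iteration, with coefficients Lipschitz in $x$) of $F'(x)=\big(\sum_{i\ge1}a_i(x)t^iX_i\big)F(x)$, $F_a(0)=I$, and set $E(a)=F_a(T)\in G$. $G(X):=E(X)$ and $E(X^2)$ are subgroups of $G$; the group of formal paths $G_f(X)$ is the closure of $G(X)$ in $G$, and $G_f(X^2)$ (formal paths in $\mathbb{C}^2$) is the closure of $E(X^2)$ in $G_f(X)$. (The paper defines $G(X)$ as a quotient of $X$ and $G_f(X)$ as its completion and identifies them with these subgroups.) Formal centers. For $a\in X$ let $I_{i_1,\dots,i_k}(a)=\int\cdots\int_{0\le s_1\le\cdots\le s_k\le T}a_{i_k}(s_k)\cdots a_{i_1}(s_1)\,ds_k\cdots ds_1$, and let $\widehat I_{i_1,\dots,i_k}$ be the unique continuous function on $G_f(X)$ with $\widehat I_{i_1,\dots,i_k}(E(a))=I_{i_1,\dots,i_k}(a)$, $a\in X$. Let $p_{i_1,\dots,i_k}(t)=(t-i_1+1)(t-i_1-i_2+1)\cdots(t-i_1-\cdots-i_k+1)$.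 Let $G[[r]]$ be the group of formal complex power series $r+\sum_{i\ge1}d_ir^{i+1}$ under composition. The map $\widehat P:G_f(X)\to G[[r]]$, $\widehat P(g)=r+\sum_{i\ge1}\big(\sum_{i_1+\cdots+i_k=i}p_{i_1,\dots,i_k}(i)\,\widehat I_{i_1,\dots,i_k}(g)\big)r^{i+1}$, is a group homomorphism; $\widehat{\mathcal{C}}_f:=\ker\widehat P$ is the group of formal centers. *)

(* Defs.v *)
From HB Require Import structures.
From mathcomp Require Import all_boot all_order all_algebra complex.
From mathcomp Require Import all_classical all_reals all_analysis.
Set Implicit Arguments.
Unset Strict Implicit.
Unset Printing Implicit Defensive.
Import Order.TTheory GRing.Theory Num.Theory numFieldNormedType.Exports.
Local Open Scope classical_set_scope.
Local Open Scope ring_scope.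
Local Open Scope complex_scope.

Definition posnat := {i : nat | (0 < i)%N}.
Definition word := seq posnat.
Definition weight (w : word) : nat := (\sum_(i <- w) val i)%N.

(* An element of the algebra A is stored as its coefficient function
   [:: i_1; ..; i_k] |-> c_{i_1,..,i_k}.  The variable t is left implicit: in A
   the monomial X_{i_1}..X_{i_k} only occurs with the factor t^(i_1+..+i_k), so
   t^n selects the words of weight n.  Noncommutative polynomials in the X_i
   are the same kind of functions (those of finite support); under this
   identification X_i and X_i t^i are both the indicator of the word [:: i]. *)
Definition ncseries (R : realType) := word -> R[i]^o.

Section Algebra.
Variable R : realType.
Local Notation A := (ncseries R).

HB.instance Definition _ := Choice.on A.
HB.instance Definition _ := GRing.Lmodule.copy A (word -> R[i]^o).
HB.instance Definition _ := isPointed.Build A 0.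
(* The weakest topology making all the coefficient functions continuous. *)
HB.instance Definition _ :=
  Topological.copy A (prod_topology (fun _ : word => R[i]^o)).

Definition ncone : A := fun w => (w == [::])%:R.

Definition ncmul (f g : A) : A :=
  fun w => \sum_(k < (size w).+1) f (take k w) * g (drop k w).

Lemma ncmul_nil f g : ncmul f g [::] = f [::] * g [::].
Proof. by rewrite /ncmul big_ord_recl big_ord0 addr0. Qed.

Lemma ncmul_cons f g i w :
  ncmul f g (i :: w) =
  f [::] * g (i :: w) + ncmul (fun v => f (i :: v)) g w.
Proof. by rewrite /ncmul big_ord_recl take0 drop0. Qed.

Lemma ncmulDl : left_distributive ncmul +%R.
Proof.
move=> f g h; apply/funext => w; rewrite /ncmul.
rewrite (_ : (_ + _ : A) w = (ncmul f h w + ncmul g h w : R[i]))//.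
by rewrite /ncmul -big_split/=; apply: eq_bigr => k _; rewrite -mulrDl.
Qed.

Lemma ncmulDr : right_distributive ncmul +%R.
Proof.
move=> f g h; apply/funext => w; rewrite /ncmul.
rewrite (_ : (_ + _ : A) w = (ncmul f g w + ncmul f h w : R[i]))//.
by rewrite /ncmul -big_split/=; apply: eq_bigr => k _; rewrite -mulrDr.
Qed.

Lemma ncmulZl c (f g : A) : c *: ncmul f g = ncmul (c *: f) g.
Proof.
apply/funext => w; rewrite (_ : (_ *: _) w = c * ncmul f g w)//.
by rewrite /ncmul big_distrr/=; apply: eq_bigr => k _; rewrite mulrA.
Qed.

Lemma ncmulZr c (f g : A) : c *: ncmul f g = ncmul f (c *: g).
Proof.
apply/funext => w; rewrite (_ : (_ *: _) w = c * ncmul f g w)//.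
rewrite /ncmul big_distrr/=; apply: eq_bigr => k _.
by rewrite mulrCA.
Qed.

Lemma ncmulA : associative ncmul.
Proof.
move=> f g h; apply/funext => w; elim: w f => [|i w IH] f.
  by rewrite !ncmul_nil mulrA.
rewrite 3!ncmul_cons IH ncmul_nil.
have -> : (fun v => ncmul f g (i :: v)) =
    f [::] *: (fun v => g (i :: v) : R[i]^o) + ncmul (fun v => f (i :: v)) g :> A.
  by apply/funext => v; rewrite ncmul_cons.
rewrite ncmulDl -ncmulZl mulrDr mulrA -!addrA.
by congr (_ + _).
Qed.

Lemma ncmul1l : left_id ncone ncmul.
Proof.
move=> f; apply/funext => -[|i w]; first by rewrite ncmul_nil mul1r.
rewrite ncmul_cons mul1r /ncmul big1 ?addr0// => k _.
by rewrite mul0r.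
Qed.

Lemma ncmul1r : right_id ncone ncmul.
Proof.
move=> f; apply/funext => w; elim: w f => [|i w IH] f.
  by rewrite ncmul_nil mulr1.
by rewrite ncmul_cons IH mulr0 add0r.
Qed.

Lemma ncone_neq0 : ncone != 0 :> A.
Proof. by apply/eqP => /(congr1 (@^~ [::]))/eqP; rewrite oner_eq0. Qed.

HB.instance Definition _ := GRing.Zmodule_isNzRing.Build A
  ncmulA ncmul1l ncmul1r ncmulDl ncmulDr ncone_neq0.
HB.instance Definition _ := GRing.Lmodule_isLalgebra.Build R[i] A ncmulZl.
HB.instance Definition _ := GRing.Lalgebra_isAlgebra.Build R[i] A ncmulZr.

Definition ncinvertible (f : A) : bool :=
  `[< exists g : A, g * f = 1 /\ f * g = 1 >].

Definition ncinv (f : A) : A := xget f [set g | g * f = 1 /\ f * g = 1].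

Lemma ncinvP (f : A) :
  ncinvertible f -> ncinv f * f = 1 /\ f * ncinv f = 1.
Proof.
by move=> /asboolP[g fg]; rewrite /ncinv; case: xgetP => [_ -> //|/(_ g)].
Qed.

Lemma ncmulVr : {in ncinvertible, left_inverse 1 ncinv *%R}.
Proof. by move=> f /ncinvP[]. Qed.

Lemma ncmulrV : {in ncinvertible, right_inverse 1 ncinv *%R}.
Proof. by move=> f /ncinvP[]. Qed.

Lemma ncunitP (f g : A) : g * f = 1 /\ f * g = 1 -> ncinvertible f.
Proof. by move=> fg; apply/asboolP; exists g. Qed.

Lemma ncinv_out : {in [predC ncinvertible], ncinv =1 id}.
Proof.
move=> f; rewrite inE/= => /asboolPn nf; rewrite /ncinv.
by case: xgetP => // g _ fg; case: nf; exists g.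
Qed.

HB.instance Definition _ := GRing.NzRing_hasMulInverse.Build A
  ncmulVr ncmulrV ncunitP ncinv_out.

End Algebra.

Section Lie.
Variable R : realType.
Local Notation A := (ncseries R).

Definition unital_series : set A := [set f | f [::] = 1].

Definition augmentation : set A := [set f | f [::] = 0].

Definition ncexp (f : A) : A := limn (series (fun n => (n`!)%:R^-1 *: f ^+ n)).

Definition lie (f g : A) : A := f * g - g * f.

(* X_i, for i >= 1 *)
Definition gen (i : nat) : A := fun w => (map val w == [:: i])%:R.

Definition lie_subalgebra (L : set A) :=
  [/\ L 0, (forall c f g, L f -> L g -> L (c *: f + g)) &
      (forall f g, L f -> L g -> L (lie f g))].

Definition free_lie (n : nat) : set A :=
  smallest lie_subalgebra [set gen i | i in [set i | (1 <= i <= n)%N]].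

(* the coefficient f_n of t^n *)
Definition tcoef (n : nat) (f : A) : A :=
  fun w => if weight w == n then f w else 0.

Definition lie_elements : set A :=
  [set f | augmentation f /\ forall n, (0 < n)%N -> free_lie n (tcoef n f)].

Definition closed_lie_ideal (L J : set A) :=
  [/\ J `<=` L, lie_subalgebra J, (forall f h, L f -> J h -> J (lie f h)) &
      L `&` closure J `<=` J].

Definition s_elt (i : nat) : A :=
  gen i - (i%:R - 2%:R)^-1 *: lie (gen i.-1) (gen 1).

Definition calN : set A :=
  smallest (closed_lie_ideal lie_elements)
           [set s_elt i | i in [set i | (3 <= i)%N]].

End Lie.
Arguments unital_series R : clear implicits.
Arguments augmentation R : clear implicits.
Arguments lie_elements R : clear implicits.
Arguments calN R : clear implicits.

Section Groups.
Variable R : realType.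
Local Notation A := (ncseries R).

Definition subgroup_of (K H : set A) :=
  [/\ H `<=` K, H 1, (forall f g, H f -> H g -> H (f * g)) &
      (forall f, H f -> H f^-1)].

Definition normal_subgroup_of (K H : set A) :=
  subgroup_of K H /\ forall g h, K g -> H h -> H (g * h * g^-1).

Definition closed_normal_subgroup_of (K H : set A) :=
  normal_subgroup_of K H /\ K `&` closure H `<=` H.

Definition semidirect_product (K N H : set A) :=
  [/\ subgroup_of (unital_series R) K, normal_subgroup_of K N,
      subgroup_of K H, N `&` H = [set 1] &
      K = [set n * h | n in N & h in H]].

End Groups.

Section Paths.
Variables (R : realType) (T : R).
Local Notation A := (ncseries R).
Local Notation mu := (@lebesgue_measure R).
Local Notation normc := Normc.normc.
Local Notation IT := `[0, T]%classic.

(* Elements of L^oo(I_T) are given by Borel representatives; the pointwise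
   conditions imposed on them below are all almost everywhere conditions. *)
Definition Linfty (f : R -> R[i]) :=
  [/\ measurable_fun IT (fun x => complex.Re (f x)),
      measurable_fun IT (fun x => complex.Im (f x)) &
      exists M : R, {ae mu, forall x, IT x -> normc (f x) <= M}].

Definition path_space : set (posnat -> R -> R[i]) :=
  [set a | (forall i, Linfty (a i)) /\
    exists M : R, forall i : posnat,
      {ae mu, forall x, IT x -> normc (a i x) `^ (val i)%:R^-1 <= M}].

Definition path_space2 : set (posnat -> R -> R[i]) :=
  [set a | path_space a /\ forall i : posnat, (2 < val i)%N ->
      {ae mu, forall x, IT x -> a i x = 0}].

Definition velocity (a : posnat -> R -> R[i]) (x : R) : A :=
  fun w => if w is [:: i] then a i x else 0.

Definition is_solution (a : posnat -> R -> R[i]) (F : R -> A) :=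
  [/\ (forall x, IT x -> unital_series R (F x)), F 0 = 1,
      (forall w, exists L : R, forall x y, IT x -> IT y ->
         normc (F x w - F y w) <= L * `|x - y|) &
      (forall w, {ae mu, forall x, `]0, T[%classic x ->
         is_derive x 1 (fun y => complex.Re (F y w))
           (complex.Re ((velocity a x * F x) w)) /\
         is_derive x 1 (fun y => complex.Im (F y w))
           (complex.Im ((velocity a x * F x) w))})].

Definition flow (a : posnat -> R -> R[i]) : R -> A :=
  xget (fun=> 1) [set F | is_solution a F].

Definition holonomy (a : posnat -> R -> R[i]) : A := flow a T.

Definition formal_paths : set A :=
  unital_series R `&` closure (holonomy @` path_space).

Definition formal_paths2 : set A :=
  formal_paths `&` closure (holonomy @` path_space2).

Definition cintegral (D : set R) (f : R -> R[i]) : R[i] :=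
  (\int[mu]_(x in D) complex.Re (f x)) +i* (\int[mu]_(x in D) complex.Im (f x)).

(* I_{i_1,..,i_k} as a function of the upper limit x; the indices are listed as
   i_k, .., i_1, so that the outermost integration is over s_k in [0, x]. *)
Fixpoint iter_int_rev (a : posnat -> R -> R[i]) (v : word) (x : R) : R[i] :=
  if v is i :: v' then
    cintegral `[0, x]%classic (fun s => a i s * iter_int_rev a v' s)
  else 1.

Definition iter_int (a : posnat -> R -> R[i]) (w : word) : R[i] :=
  iter_int_rev a (rev w) T.

(* The continuous extension of E(a) |-> I_w(a) from G(X) to its closure is
   unique on formal_paths, which is the only place where it is evaluated. *)
Definition iter_int_hat (w : word) : A -> R[i]^o :=
  xget (fun=> 0) [set h : A -> R[i]^o | {within formal_paths, continuous h} /\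
    forall a, path_space a -> h (holonomy a) = iter_int a w].

Definition center_poly (w : word) : {poly R[i]} :=
  \prod_(j < size w) ('X - ((weight (take j.+1 w))%:R)%:P + 1).

(* A power series in r is its sequence of coefficients. *)
Definition first_return (g : A) : nat -> R[i] := fun n =>
  match n with
  | 0 => 0
  | 1 => 1
  | i.+1 => \sum_(w \in [set w : word | weight w = i])
              (center_poly w).[i%:R] * iter_int_hat w g
  end.

Definition identity_series : nat -> R[i] := fun n => (n == 1%N)%:R.

Definition formal_centers : set A :=
  [set g | formal_paths g /\ first_return g = identity_series].

End Paths.

(* Main.v *)
Require Import Defs.
From mathcomp Require Import all_boot all_order all_algebra complex.
From mathcomp Require Import all_classical all_reals all_analysis.
From mathcomp Require Import measurable_realfun ring lra.
Set Implicit Arguments.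
Unset Strict Implicit.
Unset Printing Implicit Defensive.
Import Order.TTheory GRing.Theory Num.Theory numFieldNormedType.Exports.
Local Open Scope classical_set_scope.
Local Open Scope ring_scope.
Local Open Scope complex_scope.

(* The retraction of A that fixes X_1, X_2 and maps X_i to [X_(i-1), X_1] / (i - 2)
   for i >= 3 kills every s_i, and on L_Lie its kernel is exactly N: f - retract f
   lies in the closed ideal N when f is a generator, hence for every Lie series f.
   Moreover G_f(X) = exp(L_Lie). A holonomy satisfies (dynkin g) g = euler g, by
   uniqueness for linear differential equations, and this closed condition forces
   log g to be a Lie series; conversely, the closure of the group generated by the
   exp(c X_i), which are holonomies of piecewise constant paths, contains exp(L_Lie)
   by the Trotter formula. So exp(N) and G_f(X^2) are the kernel and the image of the
   retraction on G_f(X). Minimality follows in the same way: the series f for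
   which all exp(c f) lie in a closed normal subgroup form a closed ideal.
   Finally X_i |-> r^(i+1) d/dr is a representation that kills N, and the
   coefficients of the first return map are matrix entries of it. *)

(** * Words and coefficients *)

(** The Dynkin identity serves as the criterion for group-like series because its defect solves a
    linear differential equation with initial value 0 and because it is a closed condition, so it
    passes from holonomies to their closure. Products in exp(L_Lie) are never computed by a
    Baker-Campbell-Hausdorff formula: their stability comes out of the identification with a closure
    of products of exponentials of generators. The analytic obstacle is that a flow is specified
    only by Lipschitz coefficients and derivatives almost everywhere. The equation is triangular in
    the length of words, so uniqueness reduces to one scalar fact, that a Lipschitz function with
    derivative 0 almost everywhere is constant, and existence to Lebesgue differentiation applied to
    iterated integrals. On the algebraic side only finitely many words have a given weight. Hence
    linear maps that respect the weight filtration are continuous and determined on words, and exp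
    can be inverted one weight at a time. *)

Lemma weight_nil : weight [::] = 0%N.
Proof. by rewrite /weight big_nil. Qed.

Lemma weight_cons i w : weight (i :: w) = (val i + weight w)%N.
Proof. by rewrite /weight big_cons. Qed.

Lemma weight_cat u v : weight (u ++ v) = (weight u + weight v)%N.
Proof. by rewrite /weight big_cat. Qed.

Lemma weight_take_drop k w : (weight (take k w) + weight (drop k w))%N = weight w.
Proof. by rewrite -weight_cat cat_take_drop. Qed.

Lemma weight_rev w : weight (rev w) = weight w.
Proof. by rewrite /weight; apply: perm_big; rewrite perm_rev. Qed.

Lemma weight_eq0 w : (weight w == 0%N) = (w == [::]).
Proof.
case: w => [|[i i0] w]; first by rewrite weight_nil.
by rewrite weight_cons addn_eq0 /= gtn_eqF.
Qed.

Definition letters (n : nat) : seq posnat := pmap insub (iota 0 n).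

(** Letters are positive, so removing one lowers the weight by at least 1; this bounds the recursion
    and makes the list finite. Sums over it replace the infinite sums over all words. *)
Fixpoint words_below (n : nat) : seq word :=
  if n is n'.+1 then
    [::] :: undup [seq v <- [seq i :: w | i <- letters n, w <- words_below n']
                  | (weight v < n)%N]
  else [::].

Lemma mem_words_below n w : (w \in words_below n) = (weight w < n)%N.
Proof.
elim: n w => [|n IH] w; first by rewrite ltn0.
case: w => [|i w]; first by rewrite /= in_cons weight_nil.
rewrite [words_below _]/= in_cons mem_undup mem_filter /=.
case: (ltnP (weight (i :: w)) n.+1) => //= lt; apply/allpairsP.
exists (i, w) => /=; split => //.
  rewrite mem_pmap_sub mem_iota add0n /=.
  by apply: leq_ltn_trans lt; rewrite weight_cons leq_addr.
by rewrite IH -(ltn_add2l 1) (leq_trans _ lt)// !ltnS weight_cons leq_add// (valP i).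
Qed.

Lemma words_below_uniq n : uniq (words_below n).
Proof.
case: n => // n /=; rewrite undup_uniq mem_undup mem_filter andbT.
by apply/negP => /andP[_ /allpairsP[x []]].
Qed.

Section Series.
Variable R : realType.
Local Notation A := (ncseries R).
Implicit Types (f g h : A) (u v w : word) (c : R[i]).

Lemma ncaddE f g w : (f + g) w = f w + g w. Proof. by []. Qed.
Lemma ncoppE f w : (- f) w = - f w. Proof. by []. Qed.
Lemma ncscaleE c f w : (c *: f) w = c * f w. Proof. by []. Qed.
Lemma ncmulE f g w :
  (f * g) w = \sum_(k < (size w).+1) f (take k w) * g (drop k w) :> R[i].
Proof. by []. Qed.
Lemma nconeE w : (1 : A) w = (w == [::])%:R. Proof. by []. Qed.
Lemma ncsumE I (r : seq I) (P : pred I) (F : I -> A) w :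
  (\sum_(i <- r | P i) F i) w = \sum_(i <- r | P i) F i w.
Proof. exact: (big_morph (fun f : A => f w)). Qed.
Lemma ncmul0 f g : (f * g) [::] = f [::] * g [::] :> R[i].
Proof. exact: ncmul_nil. Qed.

Definition mono v : A := fun w => (w == v)%:R.

Lemma mono_nil : mono [::] = 1. Proof. by []. Qed.

Lemma mono_cat u v : mono (u ++ v) = mono u * mono v.
Proof.
apply/funext => w; rewrite ncmulE /mono.
have [->|wuv] := eqVneq w (u ++ v).
  have su : (size u < (size (u ++ v)).+1)%N by rewrite size_cat ltnS leq_addr.
  rewrite (bigD1 (Ordinal su))//= take_size_cat// drop_size_cat// !eqxx mulr1.
  rewrite big1 ?addr0// => k /negP ku; case: eqP => [tu|]; last by rewrite mul0r.
  case: ku; apply/eqP/val_inj => /=; rewrite -{2}tu size_take.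
  by case: ifP => // /negbT; rewrite -leqNgt => H; apply/eqP; rewrite eqn_leq H -ltnS ltn_ord.
rewrite big1// => k _; case: eqP => [tu|]; last by rewrite mul0r.
case: eqP => [dv|]; last by rewrite mulr0.
by case/eqP: wuv; rewrite -tu -dv cat_take_drop.
Qed.

Lemma gen_mono (p : posnat) : gen R (val p) = mono [:: p].
Proof.
by apply/funext => -[|q [|r w]]//; rewrite /gen /mono/=.
Qed.

Lemma gen0 : gen R 0 = 0.
Proof.
apply/funext => -[|[q q0] [|r w]]//; rewrite /gen/= !eqseq_cons ?andbF//= andbT.
by rewrite gtn_eqF.
Qed.

(** The filtration of A by powers of t. Identities between series are proved modulo each step of it,
    in place of limit arguments. *)
Definition order_ge n f := forall w, (weight w < n)%N -> f w = 0.

Lemma order_geW m n f : (m <= n)%N -> order_ge n f -> order_ge m f.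
Proof. by move=> mn fn w wm; apply: fn; exact: leq_trans mn. Qed.

Lemma order_geD n f g : order_ge n f -> order_ge n g -> order_ge n (f + g).
Proof. by move=> fn gn w wn; rewrite ncaddE fn// gn// addr0. Qed.

Lemma order_geZ n c f : order_ge n f -> order_ge n (c *: f).
Proof. by move=> fn w wn; rewrite ncscaleE fn// mulr0. Qed.

Lemma order_geN n f : order_ge n f -> order_ge n (- f).
Proof. by move=> fn w wn; rewrite ncoppE fn// oppr0. Qed.

Lemma order_geB n f g : order_ge n f -> order_ge n g -> order_ge n (f - g).
Proof. by move=> fn gn; apply: order_geD => //; exact: order_geN. Qed.

Lemma order_ge_sum n I (r : seq I) (P : pred I) (F : I -> A) :
  (forall i, P i -> order_ge n (F i)) -> order_ge n (\sum_(i <- r | P i) F i).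
Proof. by move=> Fn; elim/big_ind: _ => //; exact: order_geD. Qed.

Lemma order_geM m n f g :
  order_ge m f -> order_ge n g -> order_ge (m + n) (f * g).
Proof.
move=> fm gn w wmn; rewrite ncmulE big1// => k _.
case: (ltnP (weight (take k w)) m) => [/fm ->|mt]; first by rewrite mul0r.
rewrite [g _]gn ?mulr0//; move: wmn; rewrite -(weight_take_drop k w) => H.
by rewrite -(ltn_add2l m) (leq_ltn_trans _ H)// leq_add2r.
Qed.

Lemma order_ge1P f : order_ge 1 f <-> f [::] = 0.
Proof.
split=> [/(_ [::])|f0 w]; first by rewrite weight_nil; exact.
by rewrite ltnS leqn0 weight_eq0 => /eqP ->.
Qed.

Lemma order_geX n f k : order_ge n f -> order_ge (n * k) (f ^+ k).
Proof.
move=> fn; elim: k => [|k IH]; first by rewrite muln0.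
by rewrite mulnS exprS; exact: order_geM.
Qed.

Lemma order_ge_eq f g : (forall n, order_ge n (f - g)) -> f = g.
Proof.
move=> fg; apply/funext => w; apply/eqP; rewrite -subr_eq0; apply/eqP.
exact: (fg (weight w).+1).
Qed.

Definition truncation n f : A := \sum_(v <- words_below n) f v *: mono v.

Lemma truncationE n f w : truncation n f w = if (weight w < n)%N then f w else 0.
Proof.
rewrite /truncation ncsumE -mem_words_below; case: ifPn => [wn|wn].
  rewrite (bigD1_seq w)//= ?words_below_uniq// big1 ?addr0 => [|v vw].
    by rewrite ncscaleE /mono eqxx mulr1.
  by rewrite ncscaleE /mono eq_sym (negbTE vw) mulr0.
rewrite big_seq big1// => v vn; rewrite ncscaleE /mono.
by case: eqP => [wv|]; [rewrite wv vn in wn|rewrite mulr0].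
Qed.

Lemma order_ge_truncation n f : order_ge n (f - truncation n f).
Proof. by move=> w wn; rewrite ncaddE ncoppE truncationE wn subrr. Qed.

(** * Linear maps compatible with the weight filtration *)

Section LinearMaps.
Variables (V : lmodType R[i]) (L : A -> V).
Hypothesis linL : linear L.

Lemma linmap0 : L 0 = 0.
Proof. by have := linL (-1) 0 0; rewrite scaler0 addr0 scaleN1r addNr. Qed.

Lemma linmapD f g : L (f + g) = L f + L g.
Proof. by have := linL 1 f g; rewrite !scale1r. Qed.

Lemma linmapZ c f : L (c *: f) = c *: L f.
Proof. by have := linL c f 0; rewrite linmap0 !addr0. Qed.

Lemma linmapB f g : L (f - g) = L f - L g.
Proof. by rewrite linmapD -(scaleN1r g) linmapZ scaleN1r. Qed.

Lemma linmap_sum I (r : seq I) (P : pred I) (F : I -> A) :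
  L (\sum_(i <- r | P i) F i) = \sum_(i <- r | P i) L (F i).
Proof. by apply: (big_morph L); [exact: linmapD|exact: linmap0]. Qed.

Lemma linmap_truncation n f :
  (forall g, order_ge n g -> L g = 0) ->
  L f = \sum_(v <- words_below n) f v *: L (mono v).
Proof.
move=> Ln; rewrite -[f in LHS](subrK (truncation n f)) linmapD Ln; last exact: order_ge_truncation.
by rewrite add0r linmap_sum; apply: eq_bigr => v _; rewrite linmapZ.
Qed.

End LinearMaps.

(** For such a map each coefficient of [L f] involves only finitely many coefficients of [f]. This
    gives continuity and allows identities to be checked on words alone. *)
Definition filtered (L : A -> A) :=
  linear L /\ forall n f, order_ge n f -> order_ge n (L f).

Lemma filteredE (L : A -> A) f w : filtered L ->
  L f w = \sum_(v <- words_below (weight w).+1) f v * L (mono v) w :> R[i].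
Proof.
case=> linL filtL.
have linLw : linear (fun g => L g w : R[i]^o) by move=> c g h; rewrite linL.
by rewrite (linmap_truncation linLw (n := (weight w).+1))// => g /filtL; exact.
Qed.

Lemma filtered_eq (L1 L2 : A -> A) : filtered L1 -> filtered L2 ->
  (forall v, L1 (mono v) = L2 (mono v)) -> forall f, L1 f = L2 f.
Proof.
move=> L1f L2f L12 f; apply/funext => w.
by rewrite !filteredE//; apply: eq_bigr => v _; rewrite L12.
Qed.

Lemma filtered_id : filtered id. Proof. by []. Qed.

Lemma filtered_comp L1 L2 : filtered L1 -> filtered L2 -> filtered (L1 \o L2).
Proof.
move=> [l1 f1] [l2 f2]; split=> [c f g|n f /f2/f1//].
by rewrite /= l2 l1.
Qed.

Lemma filteredD L1 L2 : filtered L1 -> filtered L2 -> filtered (fun f => L1 f + L2 f).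
Proof.
move=> [l1 f1] [l2 f2]; split=> [c f g|n f fn].
  by rewrite l1 l2 scalerDr addrACA.
by apply: order_geD; [exact: f1|exact: f2].
Qed.

Lemma filteredN L : filtered L -> filtered (fun f => - L f).
Proof.
move=> [l1 f1]; split=> [c f g|n f fn]; first by rewrite l1 scalerN opprD.
by apply: order_geN; exact: f1.
Qed.

Lemma filteredB L1 L2 : filtered L1 -> filtered L2 -> filtered (fun f => L1 f - L2 f).
Proof. by move=> ? ?; apply: filteredD => //; exact: filteredN. Qed.

Lemma filteredMl L g : filtered L -> filtered (fun f => g * L f).
Proof.
move=> [l1 f1]; split=> [c f h|n f fn]; first by rewrite l1 mulrDr scalerAr.
by rewrite -(add0n n); apply: order_geM => //; exact: f1.
Qed.

Lemma filteredMr L g : filtered L -> filtered (fun f => L f * g).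
Proof.
move=> [l1 f1]; split=> [c f h|n f fn]; first by rewrite l1 mulrDl scalerAl.
by rewrite -(addn0 n); apply: order_geM => //; exact: f1.
Qed.

Lemma filtered_cst0 g : filtered (fun f => f [::] *: g).
Proof.
split=> [c f h|n f fn].
  by rewrite ncaddE ncscaleE scalerDl scalerA.
case: n fn => // n /(_ [::]); rewrite weight_nil => ->//.
by rewrite scale0r.
Qed.

Section Extension.
Variable Phi : word -> A.
Hypothesis homPhi : forall v w, weight w != weight v -> Phi v w = 0.

(** The sum can stop at the weight of [w], since [Phi v] is homogeneous of the weight of [v]. *)
Definition linext f : A :=
  fun w => \sum_(v <- words_below (weight w).+1) f v * Phi v w.

Lemma linext_mono v : linext (mono v) = Phi v.
Proof.
apply/funext => w; rewrite /linext.
have [wv|wv] := eqVneq (weight w) (weight v); last first.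
  rewrite homPhi// big1// => u _; rewrite /mono.
  by have [->|_] := eqVneq u v; rewrite ?(homPhi wv) ?mulr0 ?mul0r.
rewrite (bigD1_seq v) ?words_below_uniq ?mem_words_below ?wv//=.
rewrite /mono eqxx mul1r big1 ?addr0// => u /negbTE ->.
by rewrite mul0r.
Qed.

Lemma filtered_linext : filtered linext.
Proof.
split=> [c f g|n f fn w wn].
  apply/funext => w; rewrite ncaddE ncscaleE /linext mulr_sumr -big_split/=.
  by apply: eq_bigr => v _; rewrite ncaddE ncscaleE mulrDl mulrA.
rewrite /linext big_seq big1// => v; rewrite mem_words_below ltnS => vw.
by rewrite fn ?mul0r//; exact: leq_ltn_trans wn.
Qed.

End Extension.

End Series.

(* The field operations below are those of K, not those of K^o: this keeps the
   unification problems syntactic when K is R[i]. *)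
Section NumFieldLimits.
Variables (K : numFieldType) (T : Type) (F : set_system T).
Context {FF : Filter F}.
Implicit Types (u v : T -> K) (l m : K).

Lemma cvg_cstK l : (fun=> l : K^o) @ F --> (l : K^o).
Proof. exact: cvg_cst. Qed.

Lemma cvgDK u v l m : (u : T -> K^o) @ F --> (l : K^o) -> (v : T -> K^o) @ F --> (m : K^o) ->
  (fun x => u x + v x : K^o) @ F --> (l + m : K^o).
Proof. exact: cvgD. Qed.

Lemma cvgBK u v l m : (u : T -> K^o) @ F --> (l : K^o) -> (v : T -> K^o) @ F --> (m : K^o) ->
  (fun x => u x - v x : K^o) @ F --> (l - m : K^o).
Proof. exact: cvgB. Qed.

Lemma cvgMK u v l m : (u : T -> K^o) @ F --> (l : K^o) -> (v : T -> K^o) @ F --> (m : K^o) ->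
  (fun x => u x * v x : K^o) @ F --> (l * m : K^o).
Proof. exact: cvgM. Qed.

Lemma cvg_sumK (I : Type) (r : seq I) (u : I -> T -> K) (l : I -> K) :
  (forall i, (u i : T -> K^o) @ F --> (l i : K^o)) ->
  (fun x => \sum_(i <- r) u i x : K^o) @ F --> (\sum_(i <- r) l i : K^o).
Proof.
move=> ul; elim: r => [|i r IH].
  by rewrite big_nil; under eq_fun do rewrite big_nil; exact: cvg_cst.
by rewrite big_cons; under eq_fun do rewrite big_cons; exact: cvgDK.
Qed.

Lemma cvgXK u l k : (u : T -> K^o) @ F --> (l : K^o) ->
  (fun x => u x ^+ k : K^o) @ F --> (l ^+ k : K^o).
Proof.
move=> ul; elim: k => [|k IH]; first exact: cvg_cst.
by rewrite exprS; under eq_fun do rewrite exprS; exact: cvgMK.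
Qed.

End NumFieldLimits.

(** Passing from k to k + 1 multiplies the sequence by (1 - k / n) / (k + 1), where n stands for
    [n.+1]. The convergence of 1 / n to 0 is a hypothesis because it fails in a field that is not
    archimedean. *)
Lemma binomial_ratio_cvg (K : numFieldType) (k : nat) :
  (fun n => n.+1%:R^-1 : K^o) @ \oo --> (0 : K^o) ->
  (fun n => 'C(n.+1, k)%:R * n.+1%:R^-1 ^+ k : K^o) @ \oo --> ((k`!)%:R^-1 : K^o).
Proof.
move=> inv0; have natK (n : nat) : n.+1%:R != 0 :> K by rewrite pnatr_eq0.
elim: k => [|k IH].
  by under eq_fun do rewrite bin0 expr0 mulr1; rewrite fact0 invr1; exact: cvg_cst.
have -> : ((k.+1)`!)%:R^-1 = k`!%:R^-1 * (1 - k%:R * 0) * k.+1%:R^-1 :> K.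
  by rewrite mulr0 subr0 mulr1 factS natrM invfM mulrC.
rewrite (_ : (fun n => _) = (fun n => 'C(n.+1, k)%:R * (n.+1%:R : K)^-1 ^+ k *
   (1 - k%:R * n.+1%:R^-1) * k.+1%:R^-1 : K^o)); last first.
  apply/funext => n; apply: (mulIf (natK k)); rewrite divfK//.
  rewrite mulrAC -natrM mulnC mul_bin_left natrM exprS.
  have -> : ((n.+1 - k)%:R * 'C(n.+1, k)%:R = (n.+1%:R - k%:R) * 'C(n.+1, k)%:R :> K).
    have [kn|kn] := leqP k n.+1; first by rewrite natrB.
    by rewrite bin_small// !mulr0.
  have := natK n; move: (n.+1%:R : K) => N N0.
  by field.
apply: cvgMK; last exact: cvg_cst.
apply: cvgMK => //; apply: cvgBK; first exact: cvg_cst.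
by apply: cvgMK; [exact: cvg_cst|exact: inv0].
Qed.

(** * Topology *)

Section Topology.
Variable R : realType.
Local Notation A := (ncseries R).
Implicit Types (f g h : A) (u v w : word) (c : R[i]).

Lemma nccvgP (T : Type) (F : set_system T) {FF : Filter F} (u : T -> A) f :
  u @ F --> f <-> forall w, (fun x => u x w : R[i]^o) @ F --> (f w : R[i]^o).
Proof.
split=> [uf w|uf].
  have /cvg_sup/(_ w) := uf.
  move=> /(cvg_app (fun g : A => g w : R[i]^o)).
  move=> /cvg_trans; apply.
  exact: (@initial_continuous A R[i]^o (fun g => g w)).
apply/cvg_sup => w; apply/cvg_image.
  (* Evaluation at [w] is onto: [z] is attained by the constant function. *)
  by rewrite eqEsubset; split => // z _; exists (fun _ => z).
move=> U /(uf w) FU; exists ((fun g : A => g w) @^-1` U) => //.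
by apply: image_preimage; rewrite eqEsubset; split => // z _; exists (fun _ => z).
Qed.

Lemma ncseries_hausdorff : hausdorff_space A.
Proof. exact: (@hausdorff_product word (fun _ => R[i]^o)). Qed.

Lemma coef_continuous w : continuous (fun g : A => g w : R[i]^o).
Proof. by move=> f; have /nccvgP := @cvg_id _ (nbhs f); exact. Qed.

Lemma coef_cvg (F : set_system A) {FF : Filter F} f w :
  F --> f -> (fun g : A => g w : R[i]^o) @ F --> (f w : R[i]^o).
Proof. by move=> Ff; apply: (cvg_trans _ (@coef_continuous w f)); exact: cvg_app. Qed.

Lemma nc_continuous (T : topologicalType) (u : T -> A) :
  (forall w (F : set_system T) (FF : Filter F) x, F --> x ->
    (fun y => u y w : R[i]^o) @ F --> (u x w : R[i]^o)) -> continuous u.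
Proof.
by move=> uc x; apply/(@nccvgP _ _ (nbhs_filter x)) => w; apply: uc; exact: cvg_id.
Qed.

Lemma filtered_cvg (L : A -> A) (T : Type) (F : set_system T) {FF : Filter F} (u : T -> A) f :
  filtered L -> u @ F --> f -> (fun x => L (u x)) @ F --> L f.
Proof.
move=> Lf /nccvgP uf; apply/nccvgP => w.
under eq_fun do rewrite (filteredE _ _ Lf).
rewrite (filteredE _ _ Lf).
apply: (@cvg_sumK R[i]) => v; apply: (@cvgMK R[i]); last exact: cvg_cstK.
exact: uf.
Qed.

Lemma filtered_continuous (L : A -> A) : filtered L -> continuous L.
Proof. by move=> Lf f; apply: (@filtered_cvg _ _ _ (nbhs_filter f) id). Qed.

Lemma nccvgM (T : Type) (F : set_system T) {FF : Filter F} (u v : T -> A) f g :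
  u @ F --> f -> v @ F --> g -> (fun x => u x * v x) @ F --> f * g.
Proof.
move=> /nccvgP uf /nccvgP vg; apply/nccvgP => w.
under eq_fun do rewrite ncmulE.
by rewrite ncmulE; apply: (@cvg_sumK R[i]) => k; apply: (@cvgMK R[i]); [exact: uf|exact: vg].
Qed.

Lemma nccvgX (T : Type) (F : set_system T) {FF : Filter F} (u : T -> A) f k :
  u @ F --> f -> (fun x => u x ^+ k) @ F --> f ^+ k.
Proof.
move=> uf; elim: k => [|k IH]; first exact: cvg_cst.
rewrite exprS; under eq_fun do rewrite exprS.
exact: nccvgM.
Qed.

Lemma nccvgD (T : Type) (F : set_system T) {FF : Filter F} (u v : T -> A) f g :
  u @ F --> f -> v @ F --> g -> (fun x => u x + v x) @ F --> f + g.
Proof.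
move=> /nccvgP uf /nccvgP vg; apply/nccvgP => w.
by apply: (@cvgDK R[i]); [exact: uf|exact: vg].
Qed.

Lemma nccvgZ (T : Type) (F : set_system T) {FF : Filter F} (c : T -> R[i]) (u : T -> A) c0 f :
  c x @[x --> F] --> (c0 : R[i]^o) -> u @ F --> f -> (fun x => c x *: u x) @ F --> c0 *: f.
Proof.
move=> cc /nccvgP uf; apply/nccvgP => w.
by apply: (@cvgMK R[i]); [exact: cc|exact: uf].
Qed.

Lemma nclim_closed (S : set A) (u : nat -> A) f : closed S ->
  u @ \oo --> f -> (forall n, S (u n)) -> S f.
Proof. by move=> Sc uf Su; apply: (closed_cvg _ Sc _ _ uf); exact: nearW. Qed.

Lemma inv_nat_cvg0 : (fun n => (n.+1%:R : R[i])^-1 : R[i]^o) @ \oo --> (0 : R[i]^o).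
Proof.
apply/pseudometric_normed_Zmodule.cvgrPdist_lt => e e0.
have /complex_realP[r er] : e \is Num.real by rewrite gtr0_real.
have r0 : 0 < r by move: e0; rewrite er ltcR.
have := @cvg_harmonic R => /pseudometric_normed_Zmodule.cvgrPdist_lt /(_ _ r0); apply: filterS => n.
rewrite !sub0r !normrN normfV ger0_norm ?ler0n// normfV ger0_norm ?ler0n// er.
by rewrite -ltcR fmorphV rmorph_nat.
Qed.

End Topology.

(** * Exponential *)

(* Identities are stated in an abstract algebra: in ncseries itself, rewriting
   keeps unfolding the ring and module structures. *)
Section AlgebraIdentities.
Variables (K : fieldType) (V : algType K).
Implicit Types (x y : V) (c : K).

Lemma exprS_sub x y k :
  x ^+ k.+1 - y ^+ k.+1 = x * (x ^+ k - y ^+ k) + (x - y) * y ^+ k.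
Proof. by rewrite [in LHS]exprS (exprS y k) mulrBr mulrBl addrA subrK. Qed.

Lemma expr1DM1B c x n : (1 + c *: x) ^+ n * (1 + c *: - x) ^+ n =
  (1 + c *: (c *: - (x * x))) ^+ n.
Proof.
have mulDB z : (1 + z) * (1 - z) = 1 - z * z.
  by rewrite mulrBr mulr1 mulrDl mul1r opprD addrA addrK.
have mulBD z : (1 - z) * (1 + z) = 1 - z * z.
  by rewrite mulrDr mulr1 mulrBl mul1r addrA subrK.
rewrite scalerN -exprMn_comm; last by rewrite /GRing.comm mulDB mulBD.
by rewrite mulDB !scalerN scalerAl scalerAr.
Qed.

Lemma telescope_sub (a b c d e : V) : a - b - c = (a - d) - (b - e) + (d - e - c).
Proof. by rewrite opprB addrA -(addrA (a - d)) (addrC (e - b)) !subrKA. Qed.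

Definition expsum N x : V := \sum_(k < N) (k`!)%:R^-1 *: x ^+ k.

Lemma expsum1 x : expsum 1 x = 1.
Proof. by rewrite /expsum big_ord1 fact0 invr1 scale1r expr0. Qed.

Lemma expsum0 N : expsum N.+1 (0 : V) = 1.
Proof.
rewrite /expsum big_ord_recl/= big1 ?addr0 ?fact0 ?invr1 ?scale1r//.
by move=> k _; rewrite exprS mul0r scaler0.
Qed.

Lemma expsumB N M x : (N <= M)%N ->
  expsum M x - expsum N x = \sum_(N <= k < M) (k`!)%:R^-1 *: x ^+ k.
Proof.
move=> NM; rewrite /expsum -!(big_mkord xpredT (fun k => (k`!)%:R^-1 *: x ^+ k)).
by rewrite (big_cat_nat (n := N))//= addrAC subrr add0r.
Qed.

Lemma expsum_sub n x y : expsum n.+2 x - expsum n.+2 y - (x - y) =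
  \sum_(2 <= k < n.+2) (k`!)%:R^-1 *: (x ^+ k - y ^+ k).
Proof.
rewrite /expsum -sumrB.
rewrite -(big_mkord xpredT (fun k => k`!%:R^-1 *: x ^+ k - k`!%:R^-1 *: y ^+ k)).
rewrite big_ltn// big_ltn// !expr0 subrr add0r !expr1 -scalerBr (_ : 1`! = 1%N)// invr1 scale1r.
by rewrite addrAC subrr add0r; apply: eq_bigr => k _; rewrite -scalerBr.
Qed.

(** The upper bound lies above both [N] and [m], which avoids comparing them; the binomials with k >
    m vanish. *)
Lemma expr1D_sub N m x : (1 + x) ^+ m - \sum_(k < N) 'C(m, k)%:R *: x ^+ k =
  \sum_(N <= k < N + m.+1) 'C(m, k)%:R *: x ^+ k.
Proof.
rewrite [1 + x]addrC exprD1n.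
have -> : \sum_(i < m.+1) x ^+ i *+ 'C(m, i) = \sum_(0 <= k < N + m.+1) 'C(m, k)%:R *: x ^+ k.
  rewrite addnC (big_cat_nat (n := m.+1)) ?leq_addr//= big_mkord.
  rewrite [X in _ + X]big_nat [X in _ + X]big1 ?addr0 => [|k /andP[mk _]].
    by apply: eq_bigr => k _; rewrite scaler_nat.
  by rewrite bin_small// scale0r.
rewrite -(big_mkord xpredT (fun k => 'C(m, k)%:R *: x ^+ k)).
by rewrite (big_cat_nat (n := N)) ?leq_addr//= addrAC subrr add0r.
Qed.

(** The exponent is positive because exponent 0 would require [g * y = 1], which is not assumed. *)
Lemma conj_expr x y g k : y * g = 1 -> (g * x * y) ^+ k.+1 = g * x ^+ k.+1 * y.
Proof.
move=> yg; elim: k => [|k IH]; first by rewrite !expr1.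
rewrite exprSr IH [in RHS]exprSr -!mulrA; congr (_ * (_ * _)).
by rewrite (mulrA y) yg mul1r.
Qed.

End AlgebraIdentities.

Section Exponential.
Variable R : realType.
Local Notation A := (ncseries R).
Implicit Types (f g h : A) (u v w : word) (c : R[i]).

Local Notation expsum := (@expsum R[i] (ncseries R)).

Lemma order_ge_pow f k : f [::] = 0 -> order_ge k (f ^+ k).
Proof. by move=> /order_ge1P/order_geX => /(_ k); rewrite mul1n. Qed.

Lemma expsum_stable N M f : f [::] = 0 -> (N <= M)%N ->
  order_ge N (expsum M f - expsum N f).
Proof.
move=> f0 NM; rewrite expsumB// big_nat; apply: order_ge_sum => k /andP[Nk _].
by apply: order_geZ; apply: order_geW Nk _; exact: order_ge_pow.
Qed.

(** Since [f ^+ k] has order at least k, the coefficient at [w] is stationary from the [N]-th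
    partial sum on, so the limit is attained. *)
Lemma ncexpE N f w : f [::] = 0 -> (weight w < N)%N -> ncexp f w = expsum N f w.
Proof.
move=> f0 wN.
suff -> : ncexp f = fun w => expsum (weight w).+1 f w.
  have := @expsum_stable (weight w).+1 N f f0 wN w (leqnn _).
  by rewrite ncaddE ncoppE => /eqP; rewrite subr_eq0 => /eqP.
rewrite /ncexp; apply: cvg_lim; first exact: ncseries_hausdorff.
apply/nccvgP => v; apply: cvg_near_cst; near=> n.
have vn : ((weight v).+1 <= n)%N by near: n; exact: nbhs_infty_ge.
have := @expsum_stable (weight v).+1 n f f0 vn v (leqnn _).
rewrite ncaddE ncoppE => /eqP; rewrite subr_eq0 => /eqP.
by move=> <-; rewrite /series/= big_mkord.
Unshelve. all: by end_near. Qed.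

Lemma order_ge_ncexp N f : f [::] = 0 -> order_ge N (ncexp f - expsum N f).
Proof. by move=> f0 w wN; rewrite ncaddE ncoppE (ncexpE f0 wN) subrr. Qed.

Lemma ncexp_nil f : f [::] = 0 -> ncexp f [::] = 1.
Proof.
move=> f0; by rewrite (@ncexpE 1)// ?weight_nil// expsum1.
Qed.

Lemma ncexp0 : ncexp (0 : A) = 1.
Proof.
by apply/funext => w; rewrite (@ncexpE (weight w).+1)// expsum0.
Qed.

Lemma ncexp_map (L : A -> A) f g : filtered L -> f [::] = 0 -> g [::] = 0 ->
  (forall k, L (f ^+ k) = g ^+ k) -> L (ncexp f) = ncexp g.
Proof.
move=> [linL filtL] f0 g0 fg; apply: order_ge_eq => n.
have -> : L (ncexp f) - ncexp g =
    L (ncexp f - expsum n f) - (ncexp g - expsum n g).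
  rewrite (linmapB linL) (_ : L (expsum n f) = expsum n g); first by rewrite opprB addrA subrK.
  by rewrite /expsum (linmap_sum linL); apply: eq_bigr => k _; rewrite (linmapZ linL) fg.
by apply: order_geB; [apply: filtL|]; exact: order_ge_ncexp.
Qed.

Lemma order_ge_expr1D N m f : f [::] = 0 ->
  order_ge N ((1 + f) ^+ m - \sum_(k < N) 'C(m, k)%:R *: f ^+ k).
Proof.
move=> f0; rewrite expr1D_sub big_nat; apply: order_ge_sum => k /andP[Nk _].
by apply: order_geZ; apply: order_geW Nk _; exact: order_ge_pow.
Qed.

(* Coefficientwise this is a finite sum of the limits 'C(n, k) / n ^ k --> 1 / k!. *)
Lemma ncexp_limit (u : nat -> A) f : (forall n, u n [::] = 0) -> u @ \oo --> f ->
  (fun n => (1 + n.+1%:R^-1 *: u n) ^+ n.+1) @ \oo --> ncexp f.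
Proof.
move=> u0 uf.
have f0 : f [::] = 0.
  have /nccvgP/(_ [::]) := uf; under eq_fun do rewrite u0.
  by move=> /(cvg_lim (@norm_hausdorff _ R[i]^o)) <-; rewrite (lim_cst (@norm_hausdorff _ R[i]^o)).
apply/nccvgP => w; pose N := (weight w).+1.
rewrite (@ncexpE N)// /expsum.
rewrite (_ : (fun n => _) = (fun n => \sum_(k < N)
  ('C(n.+1, k)%:R * n.+1%:R^-1 ^+ k) * (u n ^+ k) w : R[i]^o)); last first.
  apply/funext => n.
  have un0 : (n.+1%:R^-1 *: u n) [::] = 0 by rewrite ncscaleE u0 mulr0.
  have := @order_ge_expr1D N n.+1 _ un0 w (leqnn _).
  rewrite ncaddE ncoppE => /eqP; rewrite subr_eq0 => /eqP ->.
  rewrite ncsumE; apply: eq_bigr => k _.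
  by rewrite exprZn scalerA.
rewrite ncsumE; apply: (@cvg_sumK R[i]) => k; apply: (@cvgMK R[i]).
  by apply: binomial_ratio_cvg; exact: inv_nat_cvg0.
have c : (fun n => u n ^+ k) @ \oo --> f ^+ k by exact: nccvgX.
by move/nccvgP: c; exact.
Qed.

(** One has (1 + f/n)^n (1 - f/n)^n = (1 + u_n/n)^n with u_n = - f^2/n. As u_n tends to 0, the
    right-hand side tends to exp 0 = 1. *)
Lemma ncexpN f : f [::] = 0 -> ncexp f * ncexp (- f) = 1.
Proof.
move=> f0.
have c1 : (fun n : nat => (1 + n.+1%:R^-1 *: f) ^+ n.+1 * (1 + n.+1%:R^-1 *: - f) ^+ n.+1)
    @ \oo --> ncexp f * ncexp (- f).
  apply: nccvgM; apply: ncexp_limit; try exact: cvg_cst; move=> n; first exact: f0.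
  by rewrite ncoppE f0 oppr0.
pose u (n : nat) : A := n.+1%:R^-1 *: (- (f * f)).
have u0 n : u n [::] = 0 by rewrite /u ncscaleE ncoppE ncmul0 f0 mul0r oppr0 mulr0.
have uc : u @ \oo --> (0 : A).
  rewrite -(scale0r (- (f * f))); apply: nccvgZ; first exact: inv_nat_cvg0.
  exact: cvg_cst.
have := ncexp_limit u0 uc; rewrite ncexp0 => c2.
apply: (cvg_unique (@ncseries_hausdorff R) c1).
by apply: cvg_trans c2; apply: near_eq_cvg; apply: nearW => n; rewrite expr1DM1B.
Qed.

Lemma ncexpNl f : f [::] = 0 -> ncexp (- f) * ncexp f = 1.
Proof. by move=> f0; rewrite -{2}(opprK f) ncexpN// ncoppE f0 oppr0. Qed.

(** To first order exp behaves like the identity: in f^k - h^k each factor beyond the first raises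
    the order by one, so the terms with k >= 2 start above weight n. Both injectivity and
    surjectivity of exp are iterations of this. *)
Lemma ncexp_sub n f h : f [::] = 0 -> h [::] = 0 -> order_ge n (f - h) ->
  order_ge n.+1 (ncexp f - ncexp h - (f - h)).
Proof.
move=> f0 h0 fh.
have pw k : order_ge (n + k) (f ^+ k.+1 - h ^+ k.+1).
  elim: k => [|k IH]; first by rewrite addn0 !expr1.
  rewrite exprS_sub.
  apply: order_geD.
    by rewrite addnS -add1n; apply: order_geM => //; exact/order_ge1P.
  by apply: order_geM => //; exact: order_ge_pow.
rewrite (telescope_sub _ _ _ (expsum n.+2 f) (expsum n.+2 h)).
apply: order_geD.
  by apply: order_geB; apply: (@order_geW _ n.+1 n.+2) => //; exact: order_ge_ncexp.
rewrite expsum_sub big_nat; apply: order_ge_sum => -[|[|k]]// _.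
by apply: order_geZ; apply: order_geW (pw _); rewrite addnS ltnS leq_addr.
Qed.

Lemma ncexp_inj f h : f [::] = 0 -> h [::] = 0 -> ncexp f = ncexp h -> f = h.
Proof.
move=> f0 h0 fh; apply: order_ge_eq; elim=> [//|n IH].
have := ncexp_sub f0 h0 IH; rewrite fh subrr sub0r => /order_geN.
by rewrite opprK.
Qed.

Lemma ncexp_surj g : g [::] = 1 -> exists2 f : A, f [::] = 0 & ncexp f = g.
Proof.
move=> g1.
(* Successive correction: the error of exp is added back to its argument, and by [ncexp_sub] each
   round makes the error vanish in one more weight. *)
pose s (n : nat) : A := iter n (fun f => f + (g - ncexp f)) 0.
have s0 n : s n [::] = 0.
  elim: n => // n IH; rewrite /s iterS -/(s n) ncaddE ncaddE ncoppE.
  by rewrite ncexp_nil// g1 IH subrr addr0.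
have sg n : order_ge n.+1 (g - ncexp (s n)).
  elim: n => [|n IH].
    by apply/order_ge1P; rewrite ncaddE ncoppE ncexp_nil// g1 subrr.
  have E : s n.+1 - s n = g - ncexp (s n) by rewrite /s iterS -/(s n) addrC addKr.
  have : order_ge n.+1 (s n.+1 - s n) by rewrite E.
  move=> /(ncexp_sub (s0 _) (s0 _)) /order_geN; rewrite E.
  by congr order_ge; apply/funext => w; rewrite !(ncaddE, ncoppE) /GRing.regular; ring.
have ss n m : (n <= m)%N -> order_ge n.+1 (s m - s n).
  elim: m => [|m IH]; first by rewrite leqn0 => /eqP ->; rewrite subrr.
  rewrite leq_eqVlt => /orP[/eqP ->|nm]; first by rewrite subrr.
  have -> : s m.+1 - s n = (s m - s n) + (g - ncexp (s m)).
    by rewrite /s iterS -/(s m) addrAC.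
  by apply: order_geD; [exact: IH|apply: order_geW (sg m)].
(* The limit of the iterates, read off diagonally: coefficients of weight n no longer change after
   the n-th iterate. *)
pose f : A := fun w => s (weight w) w.
have f0 : f [::] = 0 by rewrite /f s0.
have fs n : order_ge n.+1 (f - s n).
  move=> w; rewrite ltnS => wn; rewrite ncaddE ncoppE /f.
  have := ss _ _ wn w (leqnn _); rewrite ncaddE ncoppE => /eqP.
  by rewrite subr_eq0 => /eqP ->; rewrite subrr.
exists f => //; apply: order_ge_eq => n.
have -> : ncexp f - g = (ncexp f - ncexp (s n) - (f - s n)) + (f - s n) - (g - ncexp (s n)).
  by rewrite subrK opprB addrA subrK.
apply: order_geB; last by apply: order_geW (sg n).
apply: order_geD; last by apply: order_geW (fs n).
apply: (@order_geW _ _ n.+2); first by rewrite ltnW.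
exact: (ncexp_sub f0 (s0 n) (fs n)).
Qed.

(** Unital series are units because they are exponentials, with inverse exp(- f). *)
Lemma unital_inv g : g [::] = 1 -> g * g^-1 = 1 /\ g^-1 * g = 1.
Proof.
move=> /ncexp_surj[f f0 <-]; have gu : ncexp f \is a GRing.unit.
  by apply/unitrP; exists (ncexp (- f)); rewrite ncexpN// ncexpNl.
by rewrite divrr// mulVr.
Qed.

Lemma unital_inv_uniq g h : g [::] = 1 -> g * h = 1 -> g^-1 = h.
Proof.
by move=> /unital_inv[_ gV] gh; rewrite -[LHS]mulr1 -gh mulrA gV mul1r.
Qed.

Lemma ncexpV f : f [::] = 0 -> (ncexp f)^-1 = ncexp (- f).
Proof. by move=> f0; apply: unital_inv_uniq; rewrite ?ncexp_nil// ncexpN. Qed.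

Lemma ncexp_conj g f : g [::] = 1 -> f [::] = 0 ->
  g * ncexp f * g^-1 = ncexp (g * f * g^-1).
Proof.
move=> g1 f0; have [gV Vg] := unital_inv g1.
apply: (@ncexp_map (fun x => g * x * g^-1)) => //.
- by apply: filteredMr; apply: filteredMl; exact: filtered_id.
- by rewrite !ncmul0 f0 mulr0 mul0r.
case=> [|k]; first by rewrite mulr1.
by rewrite conj_expr.
Qed.

End Exponential.

(** * The Lie algebra of a closed group *)

Section ConjugationIdentities.
Variables (K : fieldType) (V : algType K).
Implicit Types (x y h : V) (c : K).

Lemma mul1DZ c x y : (1 + c *: x) * (1 + c *: y) = 1 + c *: (x + y + c *: (x * y)).
Proof.
rewrite mulrDl mul1r mulrDr mulr1 -scalerAl -scalerAr -addrA; congr (_ + _).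
by rewrite !scalerDr addrA [c *: y + _]addrC.
Qed.

Lemma conj1DZ c x y h : (1 + c *: x) * h * (1 + c *: y) - h =
  c *: (x * h + h * y + c *: (x * h * y)).
Proof.
rewrite mulrDl mul1r -scalerAl mulrDr mulr1 mulrDl -scalerAr -scalerAl -scalerAr.
by rewrite -(addrA h) addrAC subrr add0r !scalerDr addrA.
Qed.

Lemma scale_conj c x y h : c *: (x * h * y) = x * (c *: h) * y.
Proof. by rewrite scalerAl scalerAr. Qed.

End ConjugationIdentities.

Section LieOfGroup.
Variable R : realType.
Local Notation A := (ncseries R).
Implicit Types (f g h : A) (u v w : word) (c : R[i]).

(* (exp (c f) - 1) / c, with value f at c = 0. *)
Definition expquo c f : A := fun w => \sum_(k < (weight w).+1)
  ((k.+1)`!%:R^-1 * c ^+ k) * (f ^+ k.+1) w.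

Lemma ncexpZ_expquo c f : f [::] = 0 -> ncexp (c *: f) = 1 + c *: expquo c f.
Proof.
move=> f0; apply/funext => w; rewrite (@ncexpE _ (weight w).+2) ?ncscaleE ?f0 ?mulr0//.
rewrite /expsum ncsumE big_ord_recl expr0 fact0 invr1 scale1r ncaddE ncscaleE.
congr (_ + _); rewrite mulr_sumr; apply: eq_bigr => k _.
rewrite ncscaleE exprZn ncscaleE /= /bump/= add1n exprS.
by rewrite mulrA [RHS]mulrA; congr (_ * _); rewrite mulrCA mulrA.
Qed.

Lemma expquo_cvg (c : nat -> R[i]) f : (c : nat -> R[i]^o) @ \oo --> (0 : R[i]^o) ->
  (fun n => expquo (c n) f) @ \oo --> f.
Proof.
move=> c0; apply/nccvgP => w.
have -> : f w = \sum_(k < (weight w).+1) ((k.+1)`!%:R^-1 * 0 ^+ k) * (f ^+ k.+1) w :> R[i].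
  rewrite big_ord_recl big1 => [|k _]; last by rewrite /= /bump/= add1n exprS mul0r mulr0 mul0r.
  by rewrite addr0 expr0 expr1 mulr1 (_ : 1`! = 1%N)// invr1 mul1r.
apply: (@cvg_sumK R[i]) => k; apply: (@cvgMK R[i]); last exact: cvg_cstK.
by apply: (@cvgMK R[i]); [exact: cvg_cstK|exact: (@cvgXK R[i])].
Qed.

(* Unlike ncexp, whose limit is a junk value outside L_G, this is continuous on A. *)
Definition expcoef (f : A) : A := fun w => expsum (weight w).+1 f w.

Lemma expcoefE f : f [::] = 0 -> expcoef f = ncexp f.
Proof. by move=> f0; apply/funext => w; rewrite (@ncexpE _ (weight w).+1). Qed.

Lemma expcoef_continuous : continuous (expcoef : A -> A).
Proof.
apply: nc_continuous => w F FF f Ff.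
rewrite /expcoef /expsum; under eq_fun do rewrite ncsumE.
rewrite ncsumE; apply: (@cvg_sumK R[i]) => k; apply: (@cvgMK R[i]); first exact: cvg_cstK.
have fk : (fun g : A => g ^+ k) @ F --> f ^+ k by exact: nccvgX.
by move/nccvgP: fk; exact.
Qed.

Lemma closed_aug : closed (augmentation R).
Proof.
have -> : augmentation R = (fun f : A => f [::] : R[i]^o) @^-1` [set 0] by [].
apply: closed_comp => [f _|]; first exact: coef_continuous.
exact: (accessible_closed_set1 (hausdorff_accessible (@norm_hausdorff _ R[i]^o))).
Qed.

Lemma scale_continuous c : continuous (fun f : A => c *: f).
Proof.
apply: filtered_continuous; split=> [d f g|n f]; last exact: order_geZ.
by rewrite scalerDr !scalerA mulrC.
Qed.

(** The Lie algebra of a closed group of series. All complex multiples are required, so that it is a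
    complex subspace. *)
Definition explie (C : set A) : set A :=
  [set f | f [::] = 0 /\ forall c, C (ncexp (c *: f))].

Lemma explie_closed (C : set A) : closed C -> closed (explie C).
Proof.
(* On series without constant term [expcoef] agrees with [ncexp], so the set becomes an intersection
   of preimages of [C] under maps continuous on all of A. *)
move=> Cc; have -> : explie C = augmentation R `&`
    \bigcap_(c in [set: R[i]]) ((fun f => expcoef (c *: f)) @^-1` C).
  rewrite eqEsubset; split=> f [f0 fC]; split=> //.
    by move=> c _ /=; rewrite expcoefE ?ncscaleE ?f0 ?mulr0//.
  by move=> c; rewrite -expcoefE ?ncscaleE ?f0 ?mulr0//; exact: fC.
apply: closedI; first exact: closed_aug.
apply: closed_bigI => c _; apply: closed_comp Cc => f _.
apply: (@continuous_comp _ _ _ (fun f => c *: f) expcoef); first exact: scale_continuous.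
exact: expcoef_continuous.
Qed.

Lemma explieZ C c f : explie C f -> explie C (c *: f).
Proof.
by move=> [f0 fC]; split=> [|d]; rewrite ?ncscaleE ?f0 ?mulr0// scalerA.
Qed.

Lemma explie0 (C : set A) : C 1 -> explie C 0.
Proof. by move=> C1; split=> // c; rewrite scaler0 ncexp0. Qed.

Lemma expr_mem (C : set A) : C 1 -> (forall f g, C f -> C g -> C (f * g)) ->
  forall f n, C f -> C (f ^+ n).
Proof.
move=> C1 CM f n Cf; elim: n => [//|n IH].
by rewrite exprS; exact: CM.
Qed.

(* exp f exp h is replaced by (exp (f / n) exp (h / n)) ^ n, which converges to
   exp (f + h). *)
Lemma explieD (C : set A) f h : closed C -> C 1 -> (forall f g, C f -> C g -> C (f * g)) ->
  explie C f -> explie C h -> explie C (f + h).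
Proof.
move=> Cc C1 CM [f0 Cf] [h0 Ch]; split=> [|c]; first by rewrite ncaddE f0 h0 addr0.
pose e (n : nat) : R[i] := n.+1%:R^-1.
pose x (n : nat) := expquo (e n) (c *: f); pose y (n : nat) := expquo (e n) (c *: h).
have cf0 : (c *: f) [::] = 0 by rewrite ncscaleE f0 mulr0.
have ch0 : (c *: h) [::] = 0 by rewrite ncscaleE h0 mulr0.
have xc : x @ \oo --> c *: f by apply: expquo_cvg; exact: inv_nat_cvg0.
have yc : y @ \oo --> c *: h by apply: expquo_cvg; exact: inv_nat_cvg0.
have uc : (fun n => x n + y n + e n *: (x n * y n)) @ \oo --> c *: (f + h).
  rewrite scalerDr -[c *: f + _]addr0 -(scale0r ((c *: f) * (c *: h))).
  apply: nccvgD; first exact: nccvgD.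
  by apply: nccvgZ; [exact: inv_nat_cvg0|exact: nccvgM].
have expquo0 d g : g [::] = 0 -> expquo d g [::] = 0.
  move=> g0; rewrite /expquo weight_nil big_ord1 expr1.
  by rewrite g0 mulr0.
apply: (nclim_closed Cc (ncexp_limit _ uc)) => n.
  by rewrite !ncaddE ncscaleE ncmul0 /x /y !expquo0// !mulr0 !addr0.
rewrite -mul1DZ -!ncexpZ_expquo// !scalerA; apply: expr_mem => //.
by apply: CM.
Qed.

(* The bracket is the limit of n (exp (f / n) h exp (- f / n) - h). *)
Lemma explie_lie (C : set A) f h : closed C -> C 1 -> (forall f g, C f -> C g -> C (f * g)) ->
  f [::] = 0 ->
  (forall c g, C g -> C (ncexp (c *: f) * g * (ncexp (c *: f))^-1)) ->
  explie C h -> explie C (lie f h).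
Proof.
move=> Cc C1 CM f0 fC hC; have [h0 Ch] := hC.
have cf0 c : (c *: f) [::] = 0 by rewrite ncscaleE f0 mulr0.
have conjC c : explie C (ncexp (c *: f) * h * (ncexp (c *: f))^-1).
  split=> [|d]; first by rewrite !ncmul0 h0 mulr0 mul0r.
  rewrite (_ : _ *: _ = ncexp (c *: f) * (d *: h) * (ncexp (c *: f))^-1); last exact: scale_conj.
  rewrite -ncexp_conj ?ncexp_nil ?ncscaleE ?h0 ?f0 ?mulr0//.
  by apply: fC.
pose e (n : nat) : R[i] := n.+1%:R^-1.
pose x (n : nat) := expquo (e n) f; pose y (n : nat) := expquo (e n) (- f).
have xc : x @ \oo --> f by apply: expquo_cvg; exact: inv_nat_cvg0.
have yc : y @ \oo --> - f by apply: expquo_cvg; exact: inv_nat_cvg0.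
have uc : (fun n => x n * h + h * y n + e n *: (x n * h * y n)) @ \oo --> lie f h.
  rewrite /lie -mulrN -[f * h + _]addr0 -(scale0r (f * h * - f)).
  have hc : (fun=> h) @ \oo --> h by exact: cvg_cst.
  have xhc : (fun n => x n * h) @ \oo --> f * h by exact: nccvgM.
  apply: nccvgD; first by apply: nccvgD => //; exact: nccvgM.
  by apply: nccvgZ; [exact: inv_nat_cvg0|exact: nccvgM].
apply: (nclim_closed (explie_closed Cc) uc) => n.
have -> : x n * h + h * y n + e n *: (x n * h * y n) =
    n.+1%:R *: (ncexp (e n *: f) * h * (ncexp (e n *: f))^-1 - h).
  rewrite ncexpV// -scalerN !ncexpZ_expquo ?ncoppE ?f0 ?oppr0// conj1DZ scalerA.
  by rewrite divff ?scale1r// pnatr_eq0.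
by apply: explieZ; apply: explieD => //; rewrite -scaleN1r; apply: explieZ.
Qed.

(** The inverses that occur are those of exp(c f), namely exp(- c f), and these lie in [C] by the
    definition of [explie]. This fits the closure of a set of products. *)
Lemma explie_subalgebra (C : set A) : closed C -> C 1 -> (forall f g, C f -> C g -> C (f * g)) ->
  lie_subalgebra (explie C).
Proof.
move=> Cc C1 CM; split; first exact: explie0.
  by move=> c f g Cf Cg; apply: explieD => //; exact: explieZ.
move=> f g [f0 Cf] Cg; apply: explie_lie => // c h Ch.
apply: (CM); first exact: CM.
by rewrite ncexpV ?ncscaleE ?f0 ?mulr0// -scaleNr.
Qed.

End LieOfGroup.

(** * Lie elements *)

Section LieElements.
Variable R : realType.
Local Notation A := (ncseries R).
Implicit Types (f g h : A) (u v w : word) (c : R[i]).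

Lemma lie_nil f g : lie f g [::] = 0.
Proof. by rewrite /lie ncaddE ncoppE !ncmul0 mulrC subrr. Qed.

Definition homog (n : nat) f := forall w, weight w != n -> f w = 0.

Lemma homogD n f g : homog n f -> homog n g -> homog n (f + g).
Proof. by move=> fn gn w wn; rewrite ncaddE fn// gn// addr0. Qed.

Lemma homogN n f : homog n f -> homog n (- f).
Proof. by move=> fn w wn; rewrite ncoppE fn// oppr0. Qed.

Lemma homogZ n c f : homog n f -> homog n (c *: f).
Proof. by move=> fn w wn; rewrite ncscaleE fn// mulr0. Qed.

Lemma homogM m n f g : homog m f -> homog n g -> homog (m + n) (f * g).
Proof.
move=> fm gn w wmn; rewrite ncmulE big1// => k _.
have [tm|/fm ->] := eqVneq (weight (take k w)) m; last by rewrite mul0r.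
rewrite [g _]gn ?mulr0//; apply: contraNneq wmn => dn.
by rewrite -(weight_take_drop k w) tm dn.
Qed.

Lemma homog_lie m n f g : homog m f -> homog n g -> homog (m + n) (lie f g).
Proof.
move=> fm gn; apply: homogD; first exact: homogM.
by apply: homogN; rewrite addnC; exact: homogM.
Qed.

Lemma homog_gen i : homog i (gen R i).
Proof.
move=> w wi; rewrite /gen; case: eqP => // wE.
by move: wi; rewrite /weight -(big_map val xpredT id) wE big_seq1 eqxx.
Qed.

Lemma homog_mono v : homog (weight v) (mono R v).
Proof. by move=> w wv; rewrite /mono; have [wE|//] := eqVneq w v; rewrite wE eqxx in wv. Qed.

Lemma tcoef_homog n f : homog n (tcoef n f).
Proof. by move=> w wn; rewrite /tcoef (negbTE wn). Qed.

Lemma homog_tcoef m n f : homog n f -> tcoef m f = if m == n then f else 0.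
Proof.
move=> fn; apply/funext => w; rewrite /tcoef; case: ifPn => [/eqP wm|wm].
  case: eqP => [//|mn]; rewrite fn// wm; exact/eqP.
by case: ifPn => [/eqP mn|//]; rewrite fn// -mn.
Qed.

Lemma filtered_tcoef n : filtered (tcoef n : A -> A).
Proof.
split=> [c f g|m f fm w wm]; last by rewrite /tcoef fm//; case: ifP.
apply/funext => w; rewrite ncaddE ncscaleE /tcoef; case: ifP => // _.
by rewrite mulr0 addr0.
Qed.

Lemma truncation_tcoef N f : truncation N f = \sum_(n < N) tcoef n f.
Proof.
apply/funext => w; rewrite truncationE ncsumE; case: ltnP => wN.
  rewrite (bigD1 (Ordinal wN))//= /tcoef eqxx big1 ?addr0// => n nw.
  by case: eqP => // wn; case/eqP: nw; exact/val_inj.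
by rewrite big1// => n _; rewrite /tcoef gtn_eqF// (leq_trans (ltn_ord n)).
Qed.

Lemma truncation_cvg f : (fun n => truncation n f) @ \oo --> f.
Proof.
apply/nccvgP => w; apply: cvg_near_cst; near=> n.
by rewrite truncationE ifT//; near: n; exact: nbhs_infty_gt.
Unshelve. all: by end_near. Qed.

Lemma tcoefM n f g : tcoef n (f * g) = \sum_(k < n.+1) tcoef k f * tcoef (n - k) g.
Proof.
apply/funext => w; rewrite ncsumE /tcoef; case: ifPn => [/eqP <-|wn].
  under eq_bigr do rewrite ncmulE.
  rewrite exchange_big/= ncmulE; apply: eq_bigr => j _.
  have tw : (weight (take j w) < (weight w).+1)%N.
    by rewrite ltnS -[leqRHS](weight_take_drop j w) leq_addr.
  rewrite (bigD1 (Ordinal tw))//= eqxx ifT; last first.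
    by rewrite -[X in (X - _)%N](weight_take_drop j w) addKn.
  rewrite big1 ?addr0// => k ktw; case: eqP => [tk|]; last by rewrite mul0r.
  by case/eqP: ktw; exact/val_inj.
rewrite big1// => k _; rewrite (@homogM k (n - k))//; [| |by rewrite subnKC// -ltnS].
- by move=> v vk; rewrite (negbTE vk).
- by move=> v vk; rewrite (negbTE vk).
Qed.

Lemma lie_subalgebraP (L : set A) : lie_subalgebra L ->
  [/\ forall f g, L f -> L g -> L (f + g), forall f g, L f -> L g -> L (f - g),
      forall c f, L f -> L (c *: f) &
      forall I (r : seq I) (P : pred I) (F : I -> A), (forall i, P i -> L (F i)) ->
      L (\sum_(i <- r | P i) F i)].
Proof.
move=> [L0 LD _].
have add f g : L f -> L g -> L (f + g) by move=> Lf; rewrite -[f]scale1r; exact: LD.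
have scale c f : L f -> L (c *: f) by move=> Lf; rewrite -[_ *: _]addr0; exact: LD.
split=> //; first by move=> f g Lf Lg; apply: add => //; rewrite -scaleN1r; exact: scale.
by move=> I r P F LF; elim/big_ind: _.
Qed.

Lemma free_lie_subalgebra n : lie_subalgebra (@free_lie R n).
Proof.
split.
- by move=> L [[L0 _ _] _].
- by move=> c f g Lf Lg L LG; have [[_ LD _] _] := LG; apply: LD; [exact: Lf|exact: Lg].
- by move=> f g Lf Lg L LG; have [[_ _ LL] _] := LG; apply: LL; [exact: Lf|exact: Lg].
Qed.

Lemma free_lie_gen n i : (1 <= i <= n)%N -> free_lie n (gen R i).
Proof. by move=> i1n L [_]; apply; exists i. Qed.

Lemma free_lie_sub n (L : set A) : lie_subalgebra L ->
  (forall i, (1 <= i <= n)%N -> L (gen R i)) -> @free_lie R n `<=` L.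
Proof. by move=> LL Lg f; apply; split=> // _ [i i1n <-]; exact: Lg. Qed.

Lemma free_lieW m n : (m <= n)%N -> @free_lie R m `<=` @free_lie R n.
Proof.
move=> mn; apply: free_lie_sub; first exact: free_lie_subalgebra.
by move=> i /andP[i1 im]; apply: free_lie_gen; rewrite i1 (leq_trans im).
Qed.

Lemma lie_elements_subalgebra : lie_subalgebra (lie_elements R).
Proof.
split.
- split=> // n n0; rewrite (linmap0 (filtered_tcoef n).1).
  by have [] := free_lie_subalgebra n.
- move=> c f g [f0 Lf] [g0 Lg]; split=> [|n n0].
    by rewrite /augmentation/= ncaddE ncscaleE f0 g0 mulr0 addr0.
  have [_ LD _] := free_lie_subalgebra n.
  by rewrite (filtered_tcoef n).1; apply: LD; [exact: Lf|exact: Lg].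
- move=> f g [f0 Lf] [g0 Lg]; split=> [|n n0]; first exact: lie_nil.
  have [_ LB _ LS] := lie_subalgebraP (free_lie_subalgebra n).
  have [L0 _ LL] := free_lie_subalgebra n.
  rewrite /lie (linmapB (filtered_tcoef n).1) !tcoefM.
  (* The sum for [g * f] is reversed so that its k-th term pairs with that of [f * g] into a bracket
     of homogeneous parts. *)
  rewrite [X in _ - X](reindex_inj rev_ord_inj)/= -sumrB; apply: LS => k _.
  rewrite subSS subKn -1?ltnS// -/(lie (tcoef k f) (tcoef (n - k) g)).
  have t0 h : h [::] = 0 -> tcoef 0 h = 0 :> A.
    move=> h0; apply/funext => w; rewrite /tcoef weight_eq0.
    by case: eqP => // ->.
  case: (posnP k) => [->|k0]; first by rewrite t0// /lie mul0r mulr0 subrr.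
  case: (posnP (n - k)) => [->|nk0]; first by rewrite t0// /lie mul0r mulr0 subrr.
  apply: LL; [apply: free_lieW (Lf _ k0)|apply: free_lieW (Lg _ nk0)].
    by rewrite -ltnS.
  exact: leq_subr.
Qed.

Lemma gen_lie_elements i : lie_elements R (gen R i).
Proof.
split=> [|n n0]; first by rewrite /augmentation/= /gen.
rewrite (homog_tcoef _ (@homog_gen i)); case: eqP => [<-|_].
  by apply: free_lie_gen; rewrite n0 leqnn.
by have [] := free_lie_subalgebra n.
Qed.

Lemma free_lie_elements n : @free_lie R n `<=` lie_elements R.
Proof.
apply: free_lie_sub; first exact: lie_elements_subalgebra.
by move=> i _; exact: gen_lie_elements.
Qed.

(** The form for a subalgebra that is not known to be closed: it reaches truncations, which are
    finite combinations of brackets. *)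
Lemma lie_elements_sub (L : set A) : lie_subalgebra L ->
  (forall i, (1 <= i)%N -> L (gen R i)) -> forall N f, lie_elements R f -> L (truncation N f).
Proof.
move=> LL Lg N f [f0 Lf]; rewrite truncation_tcoef.
have [_ _ _ LS] := lie_subalgebraP LL; apply: LS => -[[|n] nN] _ /=.
  rewrite (_ : tcoef 0 f = 0); first by case: LL.
  by apply/funext => w; rewrite /tcoef weight_eq0; case: eqP => // ->.
apply: (@free_lie_sub n.+1 L LL) (Lf _ _) => // i /andP[i1 _]; exact: Lg.
Qed.

Lemma lie_elements_closed_sub (L : set A) : lie_subalgebra L -> closed L ->
  (forall i, (1 <= i)%N -> L (gen R i)) -> lie_elements R `<=` L.
Proof.
move=> LL Lc Lg f Lf; apply: (nclim_closed Lc (@truncation_cvg f)) => n.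
exact: lie_elements_sub.
Qed.

End LieElements.

(** * The retraction with kernel N *)

Section LieRingIdentities.
Variables (K : fieldType) (V : algType K).
Implicit Types (x y z t : V) (c : K).

Definition commutator x y : V := x * y - y * x.

Lemma subrACA x y z t : (x - y) - (z - t) = (x - z) - (y - t).
Proof. by rewrite [in LHS]opprD [in RHS]opprD addrACA. Qed.

Lemma subrBB x y z : (x - y) - (x - z) = z - y.
Proof. by rewrite opprB addrC subrKA. Qed.

Lemma commutatorBl x y z : commutator (x - y) z = commutator x z - commutator y z.
Proof. by rewrite /commutator mulrBl mulrBr subrACA. Qed.

Lemma commutatorBr x y z : commutator z (x - y) = commutator z x - commutator z y.
Proof. by rewrite /commutator mulrBl mulrBr subrACA. Qed.

Lemma commutatorC x y : - commutator y x = commutator x y.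
Proof. by rewrite /commutator opprB. Qed.

Lemma commutator0l x : commutator 0 x = 0.
Proof. by rewrite /commutator mul0r mulr0 subrr. Qed.

Lemma commutator0r x : commutator x 0 = 0.
Proof. by rewrite /commutator mul0r mulr0 subrr. Qed.

(** When x' and y' are the retracts of x and y, both brackets on the right have an element of the
    ideal N as second argument. *)
Lemma commutatorB_split x y x' y' : commutator x y - commutator x' y' =
  commutator x' (y - y') - commutator y (x - x').
Proof.
by rewrite (commutatorC (x - x')) commutatorBl commutatorBr [RHS]addrC subrKA.
Qed.

End LieRingIdentities.

Section Retraction.
Variable R : realType.
Local Notation A := (ncseries R).
Implicit Types (f g h : A) (u v w : word) (c : R[i]).

Lemma lieBl f g h : lie (f - g) h = lie f h - lie g h.
Proof. exact: (@commutatorBl R[i] (ncseries R)). Qed.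
Lemma lie0l f : lie 0 f = 0.
Proof. exact: (@commutator0l R[i] (ncseries R)). Qed.
Lemma lie0r f : lie f 0 = 0.
Proof. exact: (@commutator0r R[i] (ncseries R)). Qed.
Lemma lieC f g : - lie g f = lie f g.
Proof. exact: (@commutatorC R[i] (ncseries R)). Qed.
Lemma lieB_split f g f' g' : lie f g - lie f' g' = lie f' (g - g') - lie g (f - f').
Proof. exact: (@commutatorB_split R[i] (ncseries R)). Qed.

(* The image of X_n under the retraction onto the closed subalgebra generated by
   X_1 and X_2 that kills every s_i. *)
Fixpoint retr_gen (n : nat) : A :=
  if n is n'.+1 then
    if (n <= 2)%N then gen R n else (n%:R - 2%:R)^-1 *: lie (retr_gen n') (gen R 1)
  else 0.

Lemma retr_gen_small n : (n <= 2)%N -> retr_gen n = gen R n.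
Proof. by case: n => [|[|[|n]]]//= _; rewrite gen0. Qed.

Lemma retr_genE n : (3 <= n)%N ->
  retr_gen n = (n%:R - 2%:R)^-1 *: lie (retr_gen n.-1) (gen R 1).
Proof. by case: n => [|[|[|n]]]. Qed.

Lemma homog_retr_gen n : homog n (retr_gen n).
Proof.
elim: n => [//|n IH] /=; case: ifP => _; first exact: homog_gen.
by apply: homogZ; rewrite -addn1; apply: homog_lie => //; exact: homog_gen.
Qed.

Fixpoint retr_word (v : word) : A :=
  if v is i :: v' then retr_gen (val i) * retr_word v' else 1.

Lemma homog_retr_word v : homog (weight v) (retr_word v).
Proof.
elim: v => [|i v IH] /=; first by rewrite -mono_nil; exact: homog_mono.
by rewrite weight_cons; apply: homogM => //; exact: homog_retr_gen.
Qed.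

Lemma retr_word_cat u v : retr_word (u ++ v) = retr_word u * retr_word v.
Proof. by elim: u => [|i u IH] /=; rewrite ?mul1r// IH mulrA. Qed.

Definition retract : A -> A := linext retr_word.

Lemma filtered_retract : filtered retract.
Proof. exact: filtered_linext. Qed.

Lemma retract_mono v : retract (mono R v) = retr_word v.
Proof. by apply: linext_mono => u w; exact: homog_retr_word. Qed.

Lemma retract1 : retract 1 = 1.
Proof. by rewrite -mono_nil retract_mono. Qed.

(** Both sides are filtered in each argument separately, which leaves the case of two words, where
    concatenation becomes a product. *)
Lemma retractM f g : retract (f * g) = retract f * retract g.
Proof.
have fid := @filtered_id R; have fr := filtered_retract.
apply: (filtered_eq (filtered_comp fr (filteredMr g fid)) (filteredMr (retract g) fr)) => u /=.
apply: (filtered_eq (filtered_comp fr (filteredMl _ fid)) (filteredMl _ fr)) => v /=.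
by rewrite -mono_cat !retract_mono retr_word_cat.
Qed.

Lemma retractX f n : retract (f ^+ n) = retract f ^+ n.
Proof. by elim: n => [|n IH]; rewrite ?retract1// !exprS retractM IH. Qed.

Lemma retractZ c f : retract (c *: f) = c *: retract f.
Proof. exact: (linmapZ filtered_retract.1). Qed.

Lemma retractB f g : retract (f - g) = retract f - retract g.
Proof. exact: (linmapB filtered_retract.1). Qed.

Lemma retract_lie f g : retract (lie f g) = lie (retract f) (retract g).
Proof. by rewrite /lie retractB !retractM. Qed.

Lemma retract_gen i : retract (gen R i) = retr_gen i.
Proof.
case: i => [|i]; first by rewrite gen0 (linmap0 filtered_retract.1).
rewrite -[i.+1]/(val (exist (fun i => (0 < i)%N) i.+1 isT)) gen_mono retract_mono.
by rewrite [LHS]/= mulr1.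
Qed.

Lemma retract_aug f : f [::] = 0 -> retract f [::] = 0.
Proof. by move/order_ge1P/(filtered_retract.2) => /order_ge1P. Qed.

Lemma retract_exp f : f [::] = 0 -> retract (ncexp f) = ncexp (retract f).
Proof.
move=> f0; apply: ncexp_map => //; [exact: filtered_retract|exact: retract_aug|].
exact: retractX.
Qed.

Lemma retract_unital g : g [::] = 1 -> retract g [::] = 1.
Proof.
by move=> /ncexp_surj[f f0 <-]; rewrite retract_exp// ncexp_nil// retract_aug.
Qed.

Lemma retract_s_elt i : (3 <= i)%N -> retract (s_elt R i) = 0.
Proof.
move=> i3; rewrite /s_elt retractB retractZ retract_lie !retract_gen.
by rewrite (retr_genE i3) (retr_gen_small (n := 1))// subrr.
Qed.

Lemma retract_id f : (forall v, has (fun i : posnat => (2 < val i)%N) v -> f v = 0) ->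
  retract f = f.
Proof.
move=> fv; apply/funext => w.
rewrite (filteredE _ _ filtered_retract) [RHS](filteredE _ _ (@filtered_id R)).
apply: eq_bigr => v _; have [/fv ->|] := boolP (has (fun i : posnat => (2 < val i)%N) v).
  by rewrite !mul0r.
move=> nv; congr (_ * _); rewrite retract_mono; congr (_ w).
elim: v nv => [//|i v IH] /=; rewrite negb_or -leqNgt => /andP[i2 /IH ->].
by rewrite -[i :: v]/([:: i] ++ v) mono_cat -gen_mono retr_gen_small.
Qed.

Lemma retr_gen_free_lie n : @free_lie R 2 (retr_gen n).
Proof.
have [L0 LD LL] := free_lie_subalgebra R 2.
elim: n => [//|n IH]; rewrite [retr_gen _]/=; case: ifP => n2; first exact: free_lie_gen.
have [_ _ LZ _] := lie_subalgebraP (free_lie_subalgebra R 2); apply: LZ.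
by apply: LL => //; exact: free_lie_gen.
Qed.

Lemma retract_subalgebra (L : set A) : lie_subalgebra L ->
  lie_subalgebra [set f | L (retract f)].
Proof.
move=> [L0 LD LL]; split=> /=.
- by rewrite (linmap0 filtered_retract.1).
- by move=> c f g Lf Lg; rewrite (filtered_retract.1); exact: LD.
- by move=> f g Lf Lg; rewrite retract_lie; exact: LL.
Qed.

Lemma retract_tcoef n f : tcoef n (retract f) = retract (tcoef n f).
Proof.
have ft := @filtered_tcoef R n; have fr := filtered_retract.
apply: (filtered_eq (filtered_comp ft fr) (filtered_comp fr ft)) => v /=.
rewrite retract_mono (homog_tcoef _ (@homog_mono R v)).
rewrite (homog_tcoef _ (@homog_retr_word v)); case: ifP => _.
  by rewrite retract_mono.
by rewrite (linmap0 fr.1).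
Qed.

Lemma retract_lie_elements f : lie_elements R f -> lie_elements R (retract f).
Proof.
move=> [f0 Lf]; split=> [|n n0]; first exact: retract_aug.
rewrite retract_tcoef; move: (tcoef n f) (Lf _ n0).
apply: free_lie_sub; first exact: (retract_subalgebra (free_lie_subalgebra R n)).
move=> i /andP[i1 ni] /=; rewrite retract_gen.
(* The image of X_i involves X_2 only if i >= 2, and then n >= 2 as well; X_1 is fixed. *)
have [i2|i2] := leqP i 1; first by rewrite retr_gen_small ?(leq_trans i2)//; apply: free_lie_gen; rewrite i1.
by apply: (free_lieW (m := 2)); [exact: leq_trans ni|exact: retr_gen_free_lie].
Qed.

Lemma ker_retract_closed : closed [set f : A | retract f = 0].
Proof.
rewrite (_ : mkset _ = retract @^-1` [set 0])//; apply: closed_comp => [f _|].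
  by apply: filtered_continuous; exact: filtered_retract.
exact: (accessible_closed_set1 (hausdorff_accessible (@ncseries_hausdorff R))).
Qed.

Lemma s_elt_lie i : lie_elements R (s_elt R i).
Proof.
have [_ LB LZ _] := lie_subalgebraP (lie_elements_subalgebra R).
have [_ _ LL] := lie_elements_subalgebra R.
apply: LB; first exact: gen_lie_elements.
by apply: LZ; apply: LL; exact: gen_lie_elements.
Qed.

Lemma calN_ideal : closed_lie_ideal (lie_elements R) (calN R).
Proof.
split.
- move=> f; apply; split; last by move=> _ [i _ <-]; exact: s_elt_lie.
  have [L0 LD LL] := lie_elements_subalgebra R; by split=> //; move=> f' [].
- split.
  + by move=> J [[_ [J0 _ _] _ _] _].
  + move=> c f g Nf Ng J JP; have [[_ [_ JD _] _ _] _] := JP.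
    by apply: JD; [exact: Nf|exact: Ng].
  + move=> f g Nf Ng J JP; have [[_ [_ _ JL] _ _] _] := JP.
    by apply: JL; [exact: Nf|exact: Ng].
- move=> f h Lf Nh J JP; have [[_ _ JL _] _] := JP.
  by apply: JL => //; exact: Nh.
- move=> f [Lf Nf] J JP; have [[_ _ _ JC] _] := JP.
  apply: JC; split=> //; move: f Nf {Lf}; apply: closure_subset => g; exact.
Qed.

Lemma calN_s_elt i : (3 <= i)%N -> calN R (s_elt R i).
Proof. by move=> i3 J [_]; apply; exists i. Qed.

Lemma calN_retract f : calN R f -> retract f = 0.
Proof.
(* The kernel is cut down to L_Lie because [calN] is the smallest among the closed ideals contained
   in L_Lie. *)
move=> Nf; have : (lie_elements R `&` [set f : A | retract f = 0]) f; last by case.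
move: f Nf; apply: smallest_sub; last first.
  by move=> _ [i i3 <-]; split; [exact: s_elt_lie|exact: retract_s_elt].
split; first by move=> f [].
- have [L0 LD LL] := lie_elements_subalgebra R; split.
  + by split=> //; exact: (linmap0 filtered_retract.1).
  + move=> c f g [Lf f0] [Lg g0]; split; first exact: LD.
    by rewrite /= (filtered_retract.1) f0 g0 scaler0 addr0.
  + move=> f g [Lf f0] [Lg g0]; split; first exact: LL.
    by rewrite /= retract_lie f0 lie0l.
- have [_ _ LL] := lie_elements_subalgebra R.
  move=> f h Lf [Lh h0]; split; first exact: LL.
  by rewrite /= retract_lie h0 lie0r.
- move=> f [Lf cf]; split=> //; apply: ker_retract_closed.
  by move: f cf {Lf}; apply: closure_subset => f [].
Qed.

Lemma calN_sub_retract f : lie_elements R f -> calN R (f - retract f).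
Proof.
move=> Lf; have [NL Nalg Nid Ncl] := calN_ideal.
have [_ LB LZ _] := lie_subalgebraP (lie_elements_subalgebra R).
have [L0 LD LL] := lie_elements_subalgebra R.
have [ND NB NZ _] := lie_subalgebraP Nalg; have [N0 _ _] := Nalg.
pose E : set A := [set f | lie_elements R f /\ calN R (f - retract f)].
have Ealg : lie_subalgebra E.
  split=> /=.
  - by split=> //=; rewrite (linmap0 filtered_retract.1) subrr.
  - move=> c g h [Lg Ng] [Lh Nh]; split; first exact: LD.
    rewrite filtered_retract.1 (_ : _ - _ = c *: (g - retract g) + (h - retract h)).
      by apply: ND => //; exact: NZ.
    by rewrite opprD addrACA scalerBr.
  - move=> g h [Lg Ng] [Lh Nh]; split; first exact: LL.
    rewrite retract_lie lieB_split; apply: NB; apply: Nid => //.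
    exact: retract_lie_elements.
have Egen i : E (gen R i).
  split; first exact: gen_lie_elements.
  rewrite retract_gen; elim: i => [|i IH]; first by rewrite gen0 subrr.
  have [i2|i2] := leqP i.+1 2; first by rewrite retr_gen_small// subrr.
  (* Up to [s_elt R i.+1], the difference of X_(i+1) and its retract is a multiple of
     [X_i - retract X_i, X_1], which the induction hypothesis puts in the ideal. *)
  rewrite retr_genE// -[_ - _](subrK (s_elt R i.+1)).
  apply: ND; last exact: calN_s_elt.
  rewrite (_ : _ - _ = (i.+1%:R - 2%:R)^-1 *: - lie (gen R 1) (gen R i - retr_gen i)).
    by apply: (NZ); rewrite -scaleN1r; apply: NZ; apply: Nid => //; exact: gen_lie_elements.
  rewrite (lieC (gen R i - retr_gen i)) lieBl (scalerBr _ (lie (gen R i) _)).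
  exact: (@subrBB R[i] (ncseries R)).
(* [E] is only known to contain the truncations of [f]; the limit is taken in N, which is closed
   relative to L_Lie. *)
apply: Ncl; split; first by apply: LB => //; exact: retract_lie_elements.
have cT : (fun n => truncation n f - retract (truncation n f)) @ \oo --> f - retract f.
  have fB := filteredB (@filtered_id R) filtered_retract.
  by apply: (filtered_cvg fB); exact: truncation_cvg.
apply: (nclim_closed (@closed_closure _ (calN R)) cT) => n; apply: subset_closure.
by have [] := lie_elements_sub Ealg (fun i _ => Egen i) n Lf.
Qed.

End Retraction.

(** * Group-like series *)

Section Dynkin.
Variable R : realType.
Local Notation A := (ncseries R).
Implicit Types (f g h : A) (u v w : word) (c : R[i]).

(** The derivation t d/dt. *)
Definition euler f : A := fun w => (weight w)%:R * f w.

Lemma filtered_euler : filtered euler.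
Proof.
split=> [c f g|n f fn w wn]; last by rewrite /euler fn// mulr0.
apply/funext => w; rewrite ncaddE ncscaleE /euler ncaddE ncscaleE mulrDr.
by congr (_ + _); rewrite mulrCA.
Qed.

Lemma eulerM f g : euler (f * g) = euler f * g + f * euler g.
Proof.
apply/funext => w; rewrite ncaddE /euler !ncmulE mulr_sumr -big_split/=.
apply: eq_bigr => k _; rewrite -{1}(weight_take_drop k w) natrD mulrDl mulrA.
by congr (_ + _); rewrite mulrCA.
Qed.

Lemma euler1 : euler 1 = 0.
Proof.
apply/funext => w; rewrite /euler nconeE.
by have [->|_] := eqVneq w [::]; rewrite ?weight_nil ?mul0r ?mulr0.
Qed.

Lemma euler_homog n f : homog n f -> euler f = n%:R *: f.
Proof.
move=> fn; apply/funext => w; rewrite ncscaleE /euler.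
by have [->//|wn] := eqVneq (weight w) n; rewrite fn// !mulr0.
Qed.

(** Dynkin's right-normed bracketing, with the innermost letter X_i weighted by i. This weighting
    matches the grading by weight, hence [euler], instead of the grading by length. *)
Fixpoint dynkin_word (v : word) : A :=
  if v is i :: v' then
    if v' is [::] then (val i)%:R *: mono R [:: i] else lie (mono R [:: i]) (dynkin_word v')
  else 0.

Lemma homog_dynkin_word v : homog (weight v) (dynkin_word v).
Proof.
elim: v => [//|i v IH]; have hi : homog (val i) (mono R [:: i]).
  by rewrite -gen_mono; exact: homog_gen.
case: v IH => [_|j v IH]; first by rewrite weight_cons weight_nil addn0; exact: homogZ.
by rewrite weight_cons; exact: homog_lie.
Qed.

Lemma dynkin_word_free_lie v : @free_lie R (weight v) (dynkin_word v).
Proof.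
have gi (i : posnat) n : (val i <= n)%N -> @free_lie R n (mono R [:: i]).
  by move=> ni; rewrite -gen_mono; apply: free_lie_gen; rewrite ni andbT (valP i).
elim: v => [|i v IH]; first by have [] := free_lie_subalgebra R (weight [::]).
have wi : (val i <= weight (i :: v))%N by rewrite weight_cons leq_addr.
have [_ _ LZ _] := lie_subalgebraP (free_lie_subalgebra R (weight (i :: v))).
have [_ _ LL] := free_lie_subalgebra R (weight (i :: v)).
case: v wi IH LZ LL => [|j v] wi IH LZ LL; first by apply: LZ; exact: gi.
apply: LL; first exact: gi.
by apply: free_lieW IH; rewrite [leqRHS]weight_cons leq_addl.
Qed.

Definition dynkin : A -> A := linext dynkin_word.

Lemma filtered_dynkin : filtered dynkin.
Proof. exact: filtered_linext. Qed.

Lemma dynkin_mono v : dynkin (mono R v) = dynkin_word v.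
Proof. by apply: linext_mono => u w; exact: homog_dynkin_word. Qed.

Lemma dynkin1 : dynkin 1 = 0.
Proof. by rewrite -mono_nil dynkin_mono. Qed.

Lemma dynkin_aug f : dynkin f [::] = 0.
Proof.
rewrite (filteredE _ _ filtered_dynkin) big1_seq// => v.
rewrite mem_words_below weight_nil !ltnS leqn0 weight_eq0 => /eqP ->.
by rewrite dynkin_mono mulr0.
Qed.

Lemma dynkin_lie_elements f : lie_elements R (dynkin f).
Proof.
split=> [|n n0]; first exact: dynkin_aug.
have [L0 _ _] := free_lie_subalgebra R n.
have [_ _ LZ LS] := lie_subalgebraP (free_lie_subalgebra R n).
have ft := @filtered_tcoef R n; have fd := filtered_dynkin.
have [linL filL] := filtered_comp ft fd.
have lin w : linear (fun g => (tcoef n (dynkin g)) w : R[i]^o).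
  by move=> c g h; rewrite (fd.1) (ft.1).
have -> : tcoef n (dynkin f) =
    \sum_(v <- words_below n.+1) f v *: tcoef n (dynkin (mono R v)).
  apply/funext => w; have [wn|wn] := eqVneq (weight w) n; last first.
    rewrite tcoef_homog// ncsumE big1// => v _.
    by rewrite ncscaleE tcoef_homog// mulr0.
  rewrite (linmap_truncation (lin w) (n := n.+1)) ?ncsumE// => g gn.
  by rewrite /= [LHS](filL _ _ gn) ?wn.
apply: LS => v _; apply: LZ; rewrite dynkin_mono (homog_tcoef _ (@homog_dynkin_word v)).
by case: eqP => [->|//]; exact: dynkin_word_free_lie.
Qed.

(** The constant term of [g] yields the one-letter word, the base case of [dynkin_word]; all other
    words yield brackets. *)
Lemma dynkin_consM (i : posnat) g : dynkin (mono R [:: i] * g) =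
  g [::] *: ((val i)%:R *: mono R [:: i]) + lie (mono R [:: i]) (dynkin g).
Proof.
have fd := filtered_dynkin; have fid := @filtered_id R.
have fL : filtered (fun g => lie (mono R [:: i]) (dynkin g)).
  by apply: filteredB; [exact: filteredMl|exact: filteredMr].
apply: (filtered_eq (filtered_comp fd (filteredMl _ fid))
  (filteredD (filtered_cst0 _) fL)) => v /=.
rewrite -mono_cat !dynkin_mono; case: v => [|j v].
  by rewrite /= lie0r addr0 /mono eqxx scale1r.
by rewrite {2}/mono scale0r add0r.
Qed.

Definition letter_part f : A := fun w => if size w == 1%N then f w else 0.

Lemma filtered_letter_part : filtered letter_part.
Proof.
split=> [c f g|n f fn w wn]; last by rewrite /letter_part fn//; case: ifP.
apply/funext => w; rewrite ncaddE ncscaleE /letter_part; case: ifP => // _.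
by rewrite mulr0 addr0.
Qed.

(** A velocity is supported on one-letter words, so this computes the derivative of dynkin F along a
    solution of F' = v F. *)
Lemma dynkin_letterM f g : dynkin (letter_part f * g) =
  g [::] *: euler (letter_part f) + lie (letter_part f) (dynkin g).
Proof.
have fl := filtered_letter_part; have fd := filtered_dynkin.
have fR : filtered (fun f => g [::] *: euler (letter_part f) + lie (letter_part f) (dynkin g)).
  apply: filteredD; last by apply: filteredB; [exact: filteredMr|exact: filteredMl].
  split=> [c h k|n h hn]; last by apply: order_geZ; apply: filtered_euler.2; exact: fl.2.
  by rewrite fl.1 filtered_euler.1 scalerDr !scalerA mulrC.
apply: (filtered_eq (filtered_comp fd (filteredMr g fl)) fR) => v /=.
have -> : letter_part (mono R v) = if size v == 1%N then mono R v else 0.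
  apply/funext => w; rewrite /letter_part /mono; have [->|] := eqVneq w v.
    by case: ifP => //; rewrite eqxx.
  by case: ifP; case: ifP => // _ _ /negbTE ->.
case: ifPn => [|_].
  case: v => [//|i [|j v]]// _; rewrite dynkin_consM -!gen_mono.
  by rewrite (euler_homog (@homog_gen R _)).
rewrite mul0r (linmap0 fd.1) (linmap0 filtered_euler.1) lie0l.
by rewrite scaler0 addr0.
Qed.

(* For a group-like g the logarithmic derivative (euler g) g^-1 is the Lie series
   dynkin g. *)
Definition dynkin_identity g := dynkin g * g = euler g.

Lemma dynkin_identity_closed : closed [set g | dynkin_identity g].
Proof.
have cont : continuous (fun g => dynkin g * g - euler g).
  apply: nc_continuous => w F FF g Fg; apply: (@cvgBK R[i]).
    have : (fun f => dynkin f * f) @ F --> dynkin g * g.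
      apply: nccvgM => //.
      exact: (filtered_cvg (u := id) filtered_dynkin).
    by move=> /nccvgP; exact.
  by apply: (@cvgMK R[i]); [exact: cvg_cstK|exact: coef_cvg].
rewrite (_ : mkset _ = (fun g => dynkin g * g - euler g) @^-1` [set 0]).
  apply: closed_comp => [f _|]; first exact: cont.
  exact: (accessible_closed_set1 (hausdorff_accessible (@ncseries_hausdorff R))).
rewrite eqEsubset; split=> g /=; rewrite /dynkin_identity => /eqP.
  by rewrite -subr_eq0 => /eqP.
by rewrite subr_eq0 => /eqP.
Qed.

Lemma dynkin_identity_sub g h : dynkin_identity g -> dynkin_identity h ->
  euler (g - h) = dynkin (g - h) * g + dynkin h * (g - h).
Proof.
move=> dg dh; rewrite (linmapB filtered_euler.1) -dg -dh (linmapB filtered_dynkin.1).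
by rewrite mulrBl mulrBr addrA subrK.
Qed.

(* Once the part f' of log g of weight < n is a Lie series, comparing the identity
   for g with the one for exp f' in weight n shows that n times the weight n part of
   log g is a value of dynkin. *)
Lemma log_lie_elements g : g [::] = 1 -> dynkin_identity g ->
  (forall f, lie_elements R f -> dynkin_identity (ncexp f)) ->
  exists2 f, lie_elements R f & ncexp f = g.
Proof.
move=> g1 dg dexp; have [f f0 fg] := ncexp_surj g1; exists f => //.
split=> // n; have [m] := ubnP n; elim: m n => // m IH n; rewrite ltnS => nm n0.
pose f' := truncation n f; pose d := g - ncexp f'.
have Lf' : lie_elements R f'.
  rewrite /f' truncation_tcoef.
  have [_ _ _ LS] := lie_subalgebraP (lie_elements_subalgebra R).
  apply: LS => -[[|k] kn] _ /=.
    rewrite (_ : tcoef 0 f = 0); first by have [] := lie_elements_subalgebra R.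
    by apply/funext => w; rewrite /tcoef weight_eq0; case: eqP => // ->.
  by apply: (@free_lie_elements R k.+1); apply: IH => //; exact: leq_trans nm.
have [f'0 _] := Lf'.
have dn1 : order_ge n.+1 (d - (f - f')).
  by rewrite /d -fg; apply: ncexp_sub => //; exact: order_ge_truncation.
have dn : order_ge n d.
  rewrite -[d](subrK (f - f')); apply: order_geD; last exact: order_ge_truncation.
  exact: order_geW dn1.
have ed : order_ge n.+1 (euler d - dynkin d).
  rewrite /d dynkin_identity_sub//; last exact: dexp.
  rewrite -/d [_ + dynkin _ * _]addrC -addrA -[X in - X]mulr1 -mulrBr.
  apply: order_geD.
    by rewrite -add1n; apply: order_geM => //; apply/order_ge1P; exact: dynkin_aug.
  rewrite -addn1; apply: order_geM; first exact: filtered_dynkin.2.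
  by apply/order_ge1P; rewrite ncaddE ncoppE g1 subrr.
have t0 h : order_ge n.+1 h -> tcoef n h = 0.
  by move=> hn; apply/funext => w; rewrite /tcoef; case: eqP => // wn; rewrite hn// wn.
have td : tcoef n f = tcoef n d.
  have /t0 := dn1; rewrite (linmapB (filtered_tcoef R n).1) => /eqP.
  rewrite subr_eq0 => /eqP ->; rewrite (linmapB (filtered_tcoef R n).1).
  rewrite (_ : tcoef n f' = 0) ?subr0//; apply/funext => w; rewrite /tcoef /f'.
  by case: eqP => // wn; rewrite truncationE wn ltnn.
have te : n%:R *: tcoef n f = tcoef n (dynkin d).
  have /t0 := ed; rewrite (linmapB (filtered_tcoef R n).1) => /eqP.
  rewrite subr_eq0 => /eqP <-; rewrite td; apply/funext => w.
  by rewrite ncscaleE /tcoef /euler; case: eqP => [->//|]; rewrite mulr0.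
have [_ Ld] := dynkin_lie_elements d.
have [_ _ LZ _] := lie_subalgebraP (free_lie_subalgebra R n).
rewrite -[tcoef n f]scale1r -(@mulVf _ n%:R) ?pnatr_eq0 -?lt0n// -scalerA te.
by apply: LZ; exact: Ld.
Qed.

End Dynkin.

(** Here f solves f' = v f, and d, e, g stand for dynkin f, euler v, euler f. The left-hand side is
    the derivative of the defect d f - g, which therefore solves the same linear equation as f. *)
Lemma dynkin_ode_identity (K : fieldType) (V : algType K) (e v d f g : V) :
  (e + (v * d - d * v)) * f + d * (v * f) - (e * f + v * g) = v * (d * f - g).
Proof.
rewrite mulrDl mulrBl mulrA mulrBr !mulrA opprD -addrA.
by rewrite (addrCA _ (- (e * f))) addrACA subrr add0r subrKA.
Qed.

Lemma mul_expsum (K : fieldType) (V : algType K) (c : K) (x : V) N :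
  x * expsum N (c *: x) = \sum_(k < N) ((k`!)%:R^-1 * c ^+ k) *: x ^+ k.+1.
Proof.
rewrite /expsum mulr_sumr; apply: eq_bigr => k _.
by rewrite exprZn scalerA -scalerAr -exprS.
Qed.

(** * Lipschitz primitives *)

Section LipschitzConstant.
Variable R : realType.
Local Notation mu := (@lebesgue_measure R).

Lemma aeS (P Q : R -> Prop) : (forall x, P x -> Q x) ->
  {ae mu, forall x, P x} -> {ae mu, forall x, Q x}.
Proof. by move=> PQ; apply: negligibleS => x /= nQ /PQ. Qed.

Lemma aeI (P Q : R -> Prop) : {ae mu, forall x, P x} -> {ae mu, forall x, Q x} ->
  {ae mu, forall x, P x /\ Q x}.
Proof.
move=> aP aQ; apply: negligibleS (negligibleU aP aQ) => x /=.
by move=> /not_andP.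
Qed.

Implicit Types (f : R -> R) (x y t : R).

(** Let s be the supremum of the points up to which P holds. The last hypothesis gives P at s, and
    the one before it would carry P past s if s were less than t. *)
Lemma real_induction (P : R -> Prop) t : 0 <= t -> P 0 ->
  (forall x, 0 <= x < t -> P x ->
    exists2 d, 0 < d & forall y, x < y < x + d -> y <= t -> P y) ->
  (forall x, 0 < x <= t -> (forall y, 0 <= y < x -> P y) -> P x) -> P t.
Proof.
move=> t0 P0 Pr Pl.
pose S := [set x | 0 <= x <= t /\ forall y, 0 <= y <= x -> P y].
have S0 : S 0.
  split=> [|y /andP[y0 y1]]; first by rewrite lexx.
  by rewrite (_ : y = 0)//; apply/eqP; rewrite eq_le y0 y1.
have hS : has_sup S by split; [exists 0|exists t => x [/andP[]]].
have ubS x : S x -> x <= sup S by move=> Sx; exact: ub_le_sup hS.2 _ Sx.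
have s0 : 0 <= sup S by exact: ubS.
have st : sup S <= t by apply: ge_sup; [exists 0|move=> x [/andP[]]].
have Plt y : 0 <= y < sup S -> P y.
  move=> /andP[y0 ys]; have sy : 0 < sup S - y by rewrite subr_gt0.
  have [x [_ Sx]] := sup_adherent sy hS; rewrite opprB addrC subrK => yx.
  by apply: Sx; rewrite y0 ltW.
have Ps : P (sup S).
  move: s0; rewrite le_eqVlt => /orP[/eqP <-//|s0].
  by apply: Pl => //; rewrite s0 st.
have [<-//|nst] := eqVneq (sup S) t.
have {nst} st' : sup S < t by rewrite lt_neqAle nst.
have [d d0 Pd] : exists2 d, 0 < d & forall y, sup S < y < sup S + d -> y <= t -> P y.
  by apply: Pr => //; rewrite s0.
pose e := Num.min d (t - sup S) / 2.
have e0 : 0 < e by rewrite divr_gt0// lt_min d0 subr_gt0.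
have ed : e < d.
  have : Num.min d (t - sup S) <= d by rewrite ge_min lexx.
  by rewrite ltr_pdivrMr//; lra.
have et : sup S + e <= t.
  rewrite -lerBrDl ler_pdivrMr//; have : Num.min d (t - sup S) <= t - sup S by rewrite ge_min lexx orbT.
  lra.
suff /ubS : S (sup S + e) by lra.
split=> [|y /andP[y0 ye]]; first by rewrite et; lra.
have [ys|ys] := ltP y (sup S); first by apply: Plt; rewrite y0.
have [->//|nys] := eqVneq y (sup S).
by apply: Pd; [apply/andP; split; [rewrite lt_neqAle eq_sym nys|lra]|lra].
Qed.

Let psi (U : set R) x : R := fine (mu (U `&` `[0, x])).

Let psi_fin (U : set R) x : open U -> mu (U `&` `[0, x]) \is a fin_num.
Proof.
move=> oU; have mU : measurable U by exact: open_measurable.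
rewrite ge0_fin_numE// (le_lt_trans (y := mu `[0, x]))//.
  by apply: le_measure; rewrite ?inE//; exact: measurableI.
rewrite lebesgue_measure_itv /=; case: ifP => _; last exact: ltry.
by rewrite -EFinD ltry.
Qed.

Let psi_le (U : set R) x y : open U -> x <= y -> psi U x <= psi U y.
Proof.
move=> oU xy; have mU : measurable U by exact: open_measurable.
apply: fine_le; [exact: psi_fin|exact: psi_fin|].
apply: le_measure; rewrite ?inE; [exact: measurableI|exact: measurableI|].
by apply: setIS; apply: subset_itvl; rewrite bnd_simp.
Qed.

(** Inside U the function [psi] has slope 1; multiplied by a Lipschitz constant it absorbs the
    growth of f near exceptional points. *)
Let psi_add (U : set R) x y : open U -> 0 <= x -> x <= y -> `]x, y] `<=` U ->
  psi U x + (y - x) <= psi U y.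
Proof.
move=> oU x0 xy xyU; have mU : measurable U by exact: open_measurable.
rewrite -lee_fin EFinD !fineK ?psi_fin//.
have -> : ((y - x)%:E = mu `]x, y])%E.
  rewrite lebesgue_measure_itv/= lte_fin; case: ltP => // yx.
  by rewrite (_ : y = x) ?subrr//; apply/eqP; rewrite eq_le xy yx.
rewrite -measureU//; [|exact: measurableI|].
  apply: le_measure; rewrite ?inE; [|exact: measurableI|].
    by apply: measurableU => //; exact: measurableI.
  move=> z [[Uz]|] /=; rewrite !in_itv/= => /andP[z0 zx]; split => //.
  - by apply/andP; split=> //; exact: le_trans xy.
  - by apply: xyU; rewrite /= in_itv/= z0.
  - by apply/andP; split=> //; lra.
apply/seteqP; split=> z //= [[_]]; rewrite !in_itv/=.
by move=> /andP[_ zx] /andP[xz _]; lra.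
Qed.

(* The exceptional null set is covered by an open set U of measure < e1; then
   f x - f 0 <= e1 x + L mu (U `&` [0, x]) propagates along [0, t]. *)
Lemma lipschitz_le_const f t L : 0 <= t -> 0 <= L ->
  (forall x y, 0 <= x <= t -> 0 <= y <= t -> `|f x - f y| <= L * `|x - y|) ->
  {ae mu, forall x, 0 < x < t -> is_derive x 1 f 0} ->
  f t - f 0 <= 0.
Proof.
move=> t0 L0 Lf [N [mN N0 fN]].
apply/ler_addgt0Pl => e e0; rewrite addr0.
(* Chosen so that the final bound e1 t + L e1 is at most e. *)
pose e1 := e / (t + L + 1).
have tL : 0 < t + L + 1 by lra.
have e10 : 0 < e1 by rewrite divr_gt0.
(* The point 0, where no derivative is given, is treated as exceptional too. *)
pose N' : set R := N `|` [set 0].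
have mN0 : measurable N' by apply: measurableU.
have muN0 : mu N' = 0%E.
  apply/negligibleP => //; apply: negligibleU; first exact/negligibleP.
  by apply/negligibleP => //; exact: lebesgue_measure_set1.
have [U [oU NU Ue]] : exists U : set R, [/\ open U, N' `<=` U &
    (mu (U `\` N') < e1%:E)%E].
  have fN' : (mu N' < +oo)%E by rewrite muN0 ltry.
  exact: lebesgue_regularity_outer.
have mU : measurable U by exact: open_measurable.
have {}Ue : (mu U < e1%:E)%E.
  have mD : measurable (U `\` N') by exact: measurableD.
  have dis : N' `&` (U `\` N') = set0 by rewrite setDE setICA setICr setI0.
  have -> : mu U = (mu N' + mu (U `\` N'))%E by rewrite -measureU// setDUK.
  by rewrite muN0 add0e.
have psie x : psi U x <= e1.
  rewrite -lee_fin fineK ?psi_fin//; apply/ltW/(le_lt_trans _ Ue).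
  by apply: le_measure; rewrite ?inE//; exact: measurableI.
have psi0 x : 0 <= psi U x by exact: fine_ge0.
suff H : f t - f 0 <= e1 * t + L * psi U t.
  apply: (le_trans H); have : L * psi U t <= L * e1 by exact: ler_wpM2l.
  have : e1 * (t + L + 1) = e by rewrite divfK// gt_eqF.
  nra.
apply: (real_induction (P := fun x => f x - f 0 <= e1 * x + L * psi U x)) => //.
- by rewrite subrr mulr0 add0r mulr_ge0.
- move=> x /andP[x0 xt] fx.
  (* In U the Lipschitz bound is paid for by the growth of [psi]. Outside U, x is positive and f has
     derivative 0 there, so slope e1 suffices just to the right of x. *)
  have [Ux|nUx] := pselect (U x).
    have /nbhs_ballP[d /= d0 dU] : nbhs x U by exact: open_nbhs_nbhs.
    exists d => // y /andP[xy yd] yt.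
    have : psi U x + (y - x) <= psi U y.
      apply: psi_add => //; first exact: ltW.
      move=> z /=; rewrite in_itv/= => /andP[xz zy]; apply: dU.
      by rewrite /ball/= ltr_distlC; lra.
    have := Lf y x; rewrite (gtr0_norm (x := y - x)) ?subr_gt0// => H.
    have /H{}H : 0 <= y <= t by lra.
    have /H{}H : 0 <= x <= t by lra.
    move: H => /(le_trans (ler_norm _)) H1 H2.
    have : L * (psi U x + (y - x)) <= L * psi U y by exact: ler_wpM2l.
    nra.
  have x00 : 0 < x.
    rewrite lt_neqAle x0 andbT; apply/eqP => x00; apply: nUx; apply: NU.
    by right; rewrite /= x00.
  have : is_derive x 1 f 0.
    apply: contrapT => nd; apply: nUx; apply: NU; left; apply: fN => /=.
    by move/(_ _)/nd; apply; rewrite x00.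
  move=> /is_derive1_caratheodory[g [fg gc gx]].
  have gc0 : g y @[y --> x] --> (0 : R) by rewrite -gx; exact: gc.
  have /pseudometric_normed_Zmodule.cvgrPdist_lt/(_ _ e10) := gc0.
  move=> /nbhs_ballP[d /= d0 dg]; exists d => // y /andP[xy yd] yt.
  have /dg : ball x d y by rewrite /ball/= ltr_distlC; lra.
  rewrite /= sub0r normrN => gy; have := fg y; have := psi_le oU (ltW xy).
  move=> /(ler_wpM2l L0); have : g y * (y - x) <= e1 * (y - x).
    apply: ler_wpM2r; first by rewrite subr_ge0 ltW.
    by apply: (le_trans (ler_norm _)); exact: ltW.
  nra.
- move=> x /andP[x0 xt] fx.
  apply/ler_addgt0Pl => e2 e20.
  (* A point to the left of x so close that the Lipschitz bound costs at most e2. *)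
  pose y := Num.max 0 (x - e2 / (L + 1)).
  have L1 : 0 < L + 1 by lra.
  have yx : 0 <= y < x by rewrite le_max lexx/= gt_max x0 ltrBlDr ltrDl divr_gt0.
  have := fx _ yx; have /andP[y0 yx'] := yx.
  have := psi_le oU (ltW yx') => /(ler_wpM2l L0).
  have := Lf x y; rewrite (gtr0_norm (x := x - y)) ?subr_gt0// => H.
  have /H{}H : 0 <= x <= t by lra.
  have /H{}H : 0 <= y <= t by lra.
  move: H => /(le_trans (ler_norm _)) H1 H2 H3.
  have : x - y <= e2 / (L + 1) by rewrite lerBlDr -lerBlDl le_max lexx orbT.
  rewrite ler_pdivlMr// => H4.
  nra.
Qed.

Lemma lipschitz_ae_const f t L :
  (forall x y, 0 <= x <= t -> 0 <= y <= t -> `|f x - f y| <= L * `|x - y|) ->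
  {ae mu, forall x, 0 < x < t -> is_derive x 1 f 0} ->
  forall x, 0 <= x <= t -> f x = f 0.
Proof.
move=> Lf f0 x /andP[x0 xt].
have sub (g : R -> R) : {ae mu, forall x, 0 < x < t -> is_derive x 1 g 0} ->
    {ae mu, forall y, 0 < y < x -> is_derive y 1 g 0}.
  by apply: aeS => y H /andP[y0 yx]; apply: H; rewrite y0 (lt_le_trans yx).
have L' g : (forall x y, 0 <= x <= t -> 0 <= y <= t -> `|g x - g y| <= L * `|x - y|) ->
   forall y z, 0 <= y <= x -> 0 <= z <= x -> `|g y - g z| <= `|L| * `|y - z|.
  move=> Lg y z yx zx; apply: (@le_trans _ _ (L * `|y - z|)); first by apply: Lg; lra.
  by rewrite ler_wpM2r// ler_norm.
apply/eqP; rewrite eq_le -subr_le0; apply/andP; split.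
  apply: (lipschitz_le_const (L := `|L|)) => //; first exact: L'.
  exact: sub.
rewrite -subr_le0 -[leLHS]opprK opprB.
have -> : - (f x - f 0) = (- f) x - (- f) 0 by rewrite /= opprB addrC opprK.
apply: (lipschitz_le_const (L := `|L|)) => //.
  by move=> y z yx zx; rewrite -opprD normrN; exact: L'.
apply: sub; apply: aeS f0 => y H yt; rewrite -(@oppr0 R).
by have := H yt; exact: is_deriveN.
Qed.

End LipschitzConstant.

Section Primitives.
Variables (R : realType) (T : R).
Local Notation mu := (@lebesgue_measure R).
Implicit Types (f g : R -> R) (x y t : R).

Definition lipschitz_on f := exists L, forall x y,
  0 <= x <= T -> 0 <= y <= T -> `|f x - f y| <= L * `|x - y|.

(** A class of primitives that matches [is_solution], is stable under products, and in which [f']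
    together with the value at 0 determines [f] on [0, T]. *)
Definition rprim f f' := lipschitz_on f /\
  {ae mu, forall x, 0 < x < T -> is_derive x 1 f (f' x)}.

Lemma rprim_const f : rprim f (fun=> 0) -> forall x, 0 <= x <= T -> f x = f 0.
Proof. by move=> [[L Lf] f0]; exact: (lipschitz_ae_const Lf f0). Qed.

Lemma lipschitz_cst c : lipschitz_on (fun=> c).
Proof. by exists 0 => x y _ _; rewrite subrr normr0 mul0r. Qed.

Lemma lipschitzD f g : lipschitz_on f -> lipschitz_on g -> lipschitz_on (fun x => f x + g x).
Proof.
move=> [L Lf] [M Mg]; exists (L + M) => x y xT yT.
by rewrite opprD addrACA mulrDl (le_trans (ler_normD _ _))// lerD ?Lf ?Mg.
Qed.

Lemma lipschitzN f : lipschitz_on f -> lipschitz_on (fun x => - f x).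
Proof. by move=> [L Lf]; exists L => x y xT yT; rewrite -opprD normrN Lf. Qed.

Lemma lipschitz_bounded f : lipschitz_on f ->
  exists2 M, 0 <= M & forall x, 0 <= x <= T -> `|f x| <= M.
Proof.
move=> [L Lf]; exists (`|f 0| + `|L| * `|T|) => [|x /andP[x0 xT]].
  by rewrite addr_ge0// mulr_ge0.
rewrite -[f x](subrK (f 0)) addrC (le_trans (ler_normD _ _))// lerD//.
rewrite (le_trans (Lf _ _ _ _))//; [by rewrite x0|by rewrite lexx (le_trans x0)|].
rewrite subr0 (@le_trans _ _ (`|L| * `|x|))// ?ler_wpM2r ?ler_norm//.
by rewrite ler_wpM2l// !ger0_norm// (le_trans x0).
Qed.

Lemma lipschitzM f g : lipschitz_on f -> lipschitz_on g -> lipschitz_on (fun x => f x * g x).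
Proof.
move=> Lf Lg; have [B B0 Bf] := lipschitz_bounded Lf; have [C C0 Cg] := lipschitz_bounded Lg.
have [[L {}Lf] [M {}Lg]] := (Lf, Lg); exists (L * C + B * M) => x y xT yT.
have -> : f x * g x - f y * g y = (f x - f y) * g x + f y * (g x - g y).
  by rewrite mulrBl mulrBr addrA subrK.
rewrite [leRHS]mulrDl (le_trans (ler_normD _ _))// !normrM lerD//.
  by rewrite mulrAC ler_pM ?Lf ?Cg.
by rewrite -mulrA ler_pM ?Bf ?Lg.
Qed.

Lemma rprim_ae_eq f f' g' : {ae mu, forall x, 0 < x < T -> f' x = g' x} ->
  rprim f f' -> rprim f g'.
Proof.
move=> fg [Lf df]; split => //; apply: aeS (aeI fg df) => x [E H] xT.
by rewrite -E//; exact: H.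
Qed.

Lemma rprim_cst c : rprim (fun=> c) (fun=> 0).
Proof. by split; [exact: lipschitz_cst|apply: aeW => x _; exact: is_derive_cst]. Qed.

Lemma rprimD f g f' g' : rprim f f' -> rprim g g' ->
  rprim (fun x => f x + g x) (fun x => f' x + g' x).
Proof.
move=> [Lf df] [Lg dg]; split; first exact: lipschitzD.
apply: aeS (aeI df dg) => x [dfx dgx] xT.
by have := is_deriveD (dfx xT) (dgx xT).
Qed.

Lemma rprimN f f' : rprim f f' -> rprim (fun x => - f x) (fun x => - f' x).
Proof.
move=> [Lf df]; split; first exact: lipschitzN.
by apply: aeS df => x dfx xT; have := is_deriveN (dfx xT).
Qed.

Lemma rprimB f g f' g' : rprim f f' -> rprim g g' ->
  rprim (fun x => f x - g x) (fun x => f' x - g' x).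
Proof. by move=> pf pg; apply: rprimD => //; exact: rprimN. Qed.

Lemma rprimM f g f' g' : rprim f f' -> rprim g g' ->
  rprim (fun x => f x * g x) (fun x => f' x * g x + f x * g' x).
Proof.
move=> [Lf df] [Lg dg]; split; first exact: lipschitzM.
apply: aeS (aeI df dg) => x [dfx dgx] xT.
apply: (is_derive_eq (is_deriveM (dfx xT) (dgx xT))).
by rewrite addrC /GRing.scale/= mulrC.
Qed.

Lemma measurable_bounded_integrable_itv f M : measurable_fun `[0, T] f ->
  {ae mu, forall x, 0 <= x <= T -> `|f x| <= M} -> mu.-integrable `[0, T] (EFin \o f).
Proof.
move=> mf bf; apply/integrableP; split; first exact/measurable_EFinP.
apply: (@le_lt_trans _ _ (\int[mu]_(x in `[0%R, T]) (`|M|)%:E)%E).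
  apply: ae_ge0_le_integral => //.
  - apply: measurableT_comp => //; exact/measurable_EFinP.
  - apply: aeS bf => x H xT; rewrite /= lee_fin (le_trans (H _))//; last exact: ler_norm.
rewrite integral_cst//= lebesgue_measure_itv/=; case: ifP => _; rewrite -?EFinD -?EFinM ?ltry//.
Qed.

Lemma rprim_integral f M : 0 < T -> measurable_fun `[0, T] f ->
  {ae mu, forall x, 0 <= x <= T -> `|f x| <= M} ->
  rprim (fun x => \int[mu]_(t in `[0, x]) f t) f.
Proof.
move=> T0 mf bf; have intf := measurable_bounded_integrable_itv mf bf.
have intfS (D : set R) : measurable D -> D `<=` `[0, T] -> mu.-integrable D (EFin \o f).
  by move=> mD DT; apply: integrableS intf.
have lip x y : 0 <= x -> x <= y -> y <= T ->
    `|\int[mu]_(t in `[0, y]) f t - \int[mu]_(t in `[0, x]) f t| <= `|M| * (y - x).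
  move=> x0 xy yT.
  have sub : `]x, y] `<=` `[0, T].
    by move=> z; rewrite /= !in_itv/= => /andP[xz zy]; lra.
  rewrite (Rintegral_itvB (b := BRight y)) ?bnd_simp//; last first.
    by apply: intfS => // z; rewrite /= !in_itv/= => /andP[xz zy]; lra.
  apply: (le_trans (le_normr_Rintegral _ _)) => //; first exact: intfS.
  have -> : `|M| * (y - x) = \int[mu]_(t in `]x, y]) `|M|.
    rewrite Rintegral_cst//= lebesgue_measure_itv/= lte_fin; congr (_ * _).
    by case: ltP => //= yx; apply/eqP; rewrite subr_eq0 eq_le xy yx.
  apply: fine_le.
  - apply: integrable_fin_num => //.
    by have := integrable_norm (intfS _ _ sub); apply.
  - rewrite integral_cst//= lebesgue_measure_itv/=; case: ifP => _; rewrite ?mule0//.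
  - apply: ae_ge0_le_integral => //.
    + by apply/measurable_EFinP/measurableT_comp => //; apply: measurable_funS mf.
    + apply: aeS bf => z H zT; rewrite lee_fin (le_trans (H _)) ?ler_norm//.
      exact: sub.
split.
  exists `|M| => x y /andP[x0 xT] /andP[y0 yT]; have [xy|yx] := leP x y.
    by rewrite distrC (distrC x) (ger0_norm (x := y - x)) ?subr_ge0//; exact: lip.
  by rewrite (gtr0_norm (x := x - y)) ?subr_gt0//; apply: lip => //; exact: ltW.
(* Both theorems are used for f extended by 0 outside [0, T]; near an interior point the integrals
   from 0 are unchanged. *)
have := lebesgue_differentiation (integrable_locally (measurable_itv _) intf).
apply: aeS => x lx /andP[x0 xT].
have intg : mu.-integrable `[0, T] (EFin \o (f \_ `[0, T])).
  by apply: eq_integrable intf => // z zT; rewrite /= patchE zT.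
have [|d1 d2] := FTC1_lebesgue_pt xT intg _ lx; first by rewrite lte_fin.
have xTI : x \in `[0, T]%classic by rewrite inE/= in_itv/= (ltW x0) (ltW xT).
rewrite patchE xTI in d2.
rewrite derive1E in d2.
apply: near_eq_is_derive (DeriveDef d1 d2).
have xI : x \in `]0, T[ by rewrite in_itv/= x0.
near=> y; apply: eq_Rintegral => z; rewrite inE/= in_itv/= => /andP[z0 zy].
rewrite patchE mem_set//= in_itv/= z0 (le_trans zy)//.
have : y \in `]0, T[ by near: y; exact: near_in_itvoo.
by rewrite in_itv/= => /andP[_ /ltW].
Unshelve. all: by end_near. Qed.

End Primitives.

(** * Complex-valued primitives *)

Section ComplexPrimitives.
Variables (R : realType) (T : R).
Local Notation mu := (@lebesgue_measure R).
Local Notation normc := Normc.normc.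
Implicit Types (u v : R -> R[i]) (x y : R).

Lemma ReD (a b : R[i]) : complex.Re (a + b) = complex.Re a + complex.Re b.
Proof. by case: a; case: b. Qed.
Lemma ImD (a b : R[i]) : complex.Im (a + b) = complex.Im a + complex.Im b.
Proof. by case: a; case: b. Qed.
Lemma ReN (a : R[i]) : complex.Re (- a) = - complex.Re a.
Proof. by case: a. Qed.
Lemma ImN (a : R[i]) : complex.Im (- a) = - complex.Im a.
Proof. by case: a. Qed.
Lemma ReM (a b : R[i]) :
  complex.Re (a * b) = complex.Re a * complex.Re b - complex.Im a * complex.Im b.
Proof. by case: a; case: b. Qed.
Lemma ImM (a b : R[i]) :
  complex.Im (a * b) = complex.Re a * complex.Im b + complex.Im a * complex.Re b.
Proof. by case: a; case: b. Qed.

Lemma normr_Re_le (a : R[i]) : `|complex.Re a| <= normc a.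
Proof. by case: a => a b /=; rewrite -sqrtr_sqr ler_wsqrtr// lerDl sqr_ge0. Qed.

Lemma normr_Im_le (a : R[i]) : `|complex.Im a| <= normc a.
Proof. by case: a => a b /=; rewrite -sqrtr_sqr ler_wsqrtr// lerDr sqr_ge0. Qed.

Lemma normc_le_ReIm (a : R[i]) : normc a <= `|complex.Re a| + `|complex.Im a|.
Proof.
case: a => a b /=; rewrite -[leRHS]ger0_norm ?addr_ge0// -sqrtr_sqr ler_wsqrtr//.
rewrite sqrrD !real_normK ?num_real// -addrA [in leRHS]addrCA addrA.
by rewrite -addrA lerDr mulrn_wge0// mulr_ge0.
Qed.

Definition cprim u u' :=
  rprim T (fun x => complex.Re (u x)) (fun x => complex.Re (u' x)) /\
  rprim T (fun x => complex.Im (u x)) (fun x => complex.Im (u' x)).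

Lemma cprim_ae_eq u u' v' : {ae mu, forall x, 0 < x < T -> u' x = v' x} ->
  cprim u u' -> cprim u v'.
Proof.
by move=> uv [Ru Iu]; split; (apply: rprim_ae_eq; last eassumption);
   apply: aeS uv => x H xT; rewrite H.
Qed.

Lemma cprim_eq u u' v' : (forall x, 0 < x < T -> u' x = v' x) -> cprim u u' -> cprim u v'.
Proof. by move=> uv; apply: cprim_ae_eq; exact: aeW. Qed.

Lemma cprim_const u : cprim u (fun=> 0) -> forall x, 0 <= x <= T -> u x = u 0.
Proof.
move=> [Ru Iu] x xT; apply/eqP; rewrite eq_complex.
by rewrite (rprim_const Ru)// (rprim_const Iu)// !eqxx.
Qed.

Lemma cprim_cst c : cprim (fun=> c) (fun=> 0).
Proof. by split; exact: rprim_cst. Qed.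

Lemma cprimD u v u' v' : cprim u u' -> cprim v v' ->
  cprim (fun x => u x + v x) (fun x => u' x + v' x).
Proof.
move=> [Ru Iu] [Rv Iv]; split.
  under eq_fun do rewrite ReD; under [X in rprim _ _ X]eq_fun do rewrite ReD.
  exact: rprimD.
under eq_fun do rewrite ImD; under [X in rprim _ _ X]eq_fun do rewrite ImD.
exact: rprimD.
Qed.

Lemma cprimN u u' : cprim u u' -> cprim (fun x => - u x) (fun x => - u' x).
Proof.
move=> [Ru Iu]; split.
  under eq_fun do rewrite ReN; under [X in rprim _ _ X]eq_fun do rewrite ReN.
  exact: rprimN.
under eq_fun do rewrite ImN; under [X in rprim _ _ X]eq_fun do rewrite ImN.
exact: rprimN.
Qed.

Lemma cprimB u v u' v' : cprim u u' -> cprim v v' ->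
  cprim (fun x => u x - v x) (fun x => u' x - v' x).
Proof. by move=> pu pv; apply: cprimD => //; exact: cprimN. Qed.

Lemma cprimM u v u' v' : cprim u u' -> cprim v v' ->
  cprim (fun x => u x * v x) (fun x => u' x * v x + u x * v' x).
Proof.
move=> [Ru Iu] [Rv Iv]; split.
  under eq_fun do rewrite ReM.
  under [X in rprim _ _ X]eq_fun do rewrite ReD !ReM addrACA -opprD.
  by apply: rprimB; exact: rprimM.
under eq_fun do rewrite ImM.
under [X in rprim _ _ X]eq_fun do rewrite ImD !ImM addrACA.
by apply: rprimD; exact: rprimM.
Qed.

Lemma cprimZ c u u' : cprim u u' -> cprim (fun x => c * u x) (fun x => c * u' x).
Proof.
move=> pu; apply: cprim_eq (cprimM (cprim_cst c) pu) => x _.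
by rewrite mul0r add0r.
Qed.

Lemma cprimX u u' n : cprim u u' ->
  cprim (fun x => u x ^+ n.+1) (fun x => n.+1%:R * u x ^+ n * u' x).
Proof.
move=> pu; elim: n => [|n IH].
  under eq_fun do rewrite expr1.
  by apply: cprim_eq pu => x _; rewrite expr0 !mul1r.
under eq_fun do rewrite exprS.
apply: cprim_eq (cprimM pu IH) => x _.
by rewrite !exprS -[n.+2%:R]natr1; move: (u x ^+ n) (n.+1%:R) => a b; ring.
Qed.

Lemma cprim_sum (I : Type) (r : seq I) (u u' : I -> R -> R[i]) :
  (forall i, cprim (u i) (u' i)) ->
  cprim (fun x => \sum_(i <- r) u i x) (fun x => \sum_(i <- r) u' i x).
Proof.
move=> pu; elim: r => [|i r IH].
  under eq_fun do rewrite big_nil; under [X in cprim _ X]eq_fun do rewrite big_nil.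
  exact: cprim_cst.
under eq_fun do rewrite big_cons; under [X in cprim _ X]eq_fun do rewrite big_cons.
exact: cprimD.
Qed.

Lemma lipschitz_measurable (f : R -> R) : 0 <= T -> lipschitz_on T f -> measurable_fun `[0, T] f.
Proof.
(* Composing with the projection of the line onto [0, T] gives a continuous function on the whole
   line that equals f on [0, T]. *)
move=> T0 [L Lf]; pose cl x := Num.min T (Num.max 0 x).
have clT x : 0 <= cl x <= T.
  by rewrite le_min T0 le_max lexx/= ge_min lexx.
have abs_le (a b : R) : - b <= a -> a <= b -> `|a| <= b by rewrite ler_norml => -> ->.
have nB (b c : R) : b - c <= `|b - c| /\ c - b <= `|b - c|.
  by rewrite ler_norm distrC ler_norm.
have minl (a b c : R) : `|Num.min a b - Num.min a c| <= `|b - c|.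
  by have [? ?] := nB b c; apply: abs_le; case: (leP a b) => ?; case: (leP a c) => ?; lra.
have maxl (a b c : R) : `|Num.max a b - Num.max a c| <= `|b - c|.
  by have [? ?] := nB b c; apply: abs_le; case: (leP a b) => ?; case: (leP a c) => ?; lra.
have cll x y : `|cl x - cl y| <= `|x - y| by apply: le_trans (minl _ _ _) (maxl _ _ _).
have cont : continuous (f \o cl).
  move=> x; apply/pseudometric_normed_Zmodule.cvgrPdist_lt => e e0.
  have L1 : 0 < `|L| + 1 by rewrite ltr_wpDl.
  exists (e / (`|L| + 1)) => /=; first by rewrite divr_gt0.
  move=> y /= xy; apply: (le_lt_trans (Lf _ _ (clT x) (clT y))).
  apply: (@le_lt_trans _ _ (`|L| * `|x - y|)).
    by apply: ler_pM => //; [|exact: cll] || (apply: (le_trans (ler_wpM2r _ (ler_norm L))) => //; apply: ler_wpM2l => //; exact: cll).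
  move: xy; rewrite ltr_pdivlMr// => xy; apply: le_lt_trans xy.
  by rewrite mulrDr mulr1 mulrC lerDl.
apply: (eq_measurable_fun (f \o cl)) => [x|].
  rewrite inE/= in_itv/= => /andP[x0 xT]; congr f.
  by rewrite /cl max_r// min_r.
by apply: measurable_funTS; exact: continuous_measurable_fun.
Qed.

Lemma cprim_cintegral a u u' : 0 < T -> Linfty T a -> cprim u u' ->
  cprim (fun x => cintegral `[0, x]%classic (fun s => a s * u s)) (fun x => a x * u x).
Proof.
move=> T0 [mRa mIa [M aM]] [[Ru _] [Iu _]].
have mRu := lipschitz_measurable (ltW T0) Ru; have mIu := lipschitz_measurable (ltW T0) Iu.
have [B B0 RB] := lipschitz_bounded Ru; have [C C0 IC] := lipschitz_bounded Iu.
have bd (p q : R -> R) (b c : R) : (forall x, 0 <= x <= T -> `|p x| <= b) ->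
    (forall x, 0 <= x <= T -> `|q x| <= c) ->
    {ae mu, forall x, 0 <= x <= T ->
      `|complex.Re (a x) * p x| + `|complex.Im (a x) * q x| <= M * b + M * c}.
  move=> pb qc; apply: aeS aM => x H xT; have /H Hx : `[0, T]%classic x by rewrite /= in_itv.
  rewrite !normrM lerD// ler_pM ?pb ?qc//.
  - exact: le_trans (normr_Re_le _) Hx.
  - exact: le_trans (normr_Im_le _) Hx.
split=> /=.
  apply: (@rprim_integral _ _ _ (M * B + M * C)) => //.
    rewrite (_ : (fun _ => _) = (fun t => complex.Re (a t) * complex.Re (u t) -
      complex.Im (a t) * complex.Im (u t))); last by apply/funext => t; exact: ReM.
    by apply: measurable_funB; exact: measurable_funM.
  apply: aeS (bd _ _ _ _ RB IC) => x H xT; rewrite ReM.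
  by apply: le_trans (H xT); rewrite -[X in _ <= _ + X]normrN ler_normD.
apply: (@rprim_integral _ _ _ (M * C + M * B)) => //.
  rewrite (_ : (fun _ => _) = (fun t => complex.Re (a t) * complex.Im (u t) +
    complex.Im (a t) * complex.Re (u t))); last by apply/funext => t; exact: ImM.
  by apply: measurable_funD; exact: measurable_funM.
apply: aeS (bd _ _ _ _ IC RB) => x H xT; rewrite ImM.
by apply: le_trans (H xT); rewrite ler_normD.
Qed.

Lemma cintegral_set0 u : cintegral `[0, 0]%classic u = 0.
Proof. by rewrite /cintegral set_itv1 !Rintegral_set1. Qed.

End ComplexPrimitives.

(** * Paths *)

Section Solutions.
Variables (R : realType) (T : R).
Local Notation A := (ncseries R).
Local Notation mu := (@lebesgue_measure R).
Local Notation normc := Normc.normc.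
Implicit Types (a : posnat -> R -> R[i]) (F G : R -> A).

Definition cpath F F' := forall w, cprim T (fun x => F x w) (fun x => F' x w).

Lemma cpath_eq F F' G' : (forall x, 0 < x < T -> F' x = G' x) -> cpath F F' -> cpath F G'.
Proof. by move=> FG pF w; apply: cprim_eq (pF w) => x xT; rewrite FG. Qed.

Lemma cpathB F G F' G' : cpath F F' -> cpath G G' ->
  cpath (fun x => F x - G x) (fun x => F' x - G' x).
Proof. by move=> pF pG w; exact: cprimB. Qed.

Lemma cpath_cst f : cpath (fun=> f) (fun=> 0).
Proof. by move=> w; exact: cprim_cst. Qed.

Lemma cpathM F G F' G' : cpath F F' -> cpath G G' ->
  cpath (fun x => F x * G x) (fun x => F' x * G x + F x * G' x).
Proof.
move=> pF pG w.
have := cprim_sum (index_enum 'I_(size w).+1)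
  (fun k => cprimM (pF (take k w)) (pG (drop k w))).
apply: cprim_eq => x _.
by rewrite big_split.
Qed.

Lemma cpath_filtered (L : A -> A) F F' : filtered L -> cpath F F' ->
  cpath (fun x => L (F x)) (fun x => L (F' x)).
Proof.
move=> Lf pF w.
under eq_fun do rewrite (filteredE _ _ Lf).
under [X in cprim _ _ X]eq_fun do rewrite (filteredE _ _ Lf).
apply: cprim_sum => v.
under eq_fun do rewrite mulrC; under [X in cprim _ _ X]eq_fun do rewrite mulrC.
exact: cprimZ.
Qed.

Lemma velocityM_nil a x f : (velocity a x * f) [::] = 0.
Proof. by rewrite ncmul0 mul0r. Qed.

Lemma velocityM_cons a x f i w : (velocity a x * f) (i :: w) = a i x * f w :> R[i].
Proof.
rewrite [LHS]ncmul_cons mul0r add0r.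
case: w => [|j w]; first by rewrite ncmul_nil.
rewrite ncmul_cons /= /ncmul big1 ?addr0// => k _.
by rewrite mul0r.
Qed.

(** The system is triangular: the coefficient at [i :: w] has derivative [a i] times the coefficient
    at [w]. Induction on the word makes every derivative 0, with no Gronwall estimate. *)
Lemma linear_ode_zero a F : F 0 = 0 ->
  cpath F (fun x => velocity a x * F x) -> forall x, 0 <= x <= T -> F x = 0.
Proof.
move=> F0 pF x xT; apply/funext => w; elim: w x xT => [|i w IH] x xT.
  have := pF [::]; under [X in cprim _ _ X]eq_fun do rewrite velocityM_nil.
  by move=> /cprim_const ->//; rewrite F0.
have : cprim T (fun x => F x (i :: w)) (fun=> 0).
  apply: cprim_eq (pF (i :: w)) => y /andP[y0 yT].
  by rewrite velocityM_cons IH ?mulr0// !ltW.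
by move=> /cprim_const ->//; rewrite F0.
Qed.

Lemma is_solutionP a F : is_solution T a F <->
  [/\ forall x, 0 <= x <= T -> F x [::] = 1, F 0 = 1 &
      cpath F (fun x => velocity a x * F x)].
Proof.
split=> [[Fu F0 FL Fd]|[Fu F0 pF]].
  have Fu' x : 0 <= x <= T -> F x [::] = 1 by move=> xT; apply: Fu; rewrite /= in_itv.
  split=> // w; have [L FLw] := FL w.
  split; split.
  - exists L => x y xT yT; rewrite -ReN -ReD (le_trans (normr_Re_le _))//.
    by apply: FLw; rewrite /= in_itv.
  - by apply: aeS (Fd w) => x H xT; case: H => [|? ?]//; rewrite /= in_itv.
  - exists L => x y xT yT; rewrite -ImN -ImD (le_trans (normr_Im_le _))//.
    by apply: FLw; rewrite /= in_itv.
  - by apply: aeS (Fd w) => x H xT; case: H => [|? ?]//; rewrite /= in_itv.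
split=> //.
- move=> w; have [[[L FL] _] [[M FM] _]] := pF w; exists (L + M) => x y.
  rewrite /= !in_itv/= => xT yT; rewrite (le_trans (normc_le_ReIm _))// mulrDl.
  by rewrite ReD ReN ImD ImN lerD ?FL ?FM.
- move=> w; have [[_ dR] [_ dI]] := pF w.
  by apply: aeS (aeI dR dI) => x [HR HI]; rewrite /= in_itv/= => xT; split; [exact: HR|exact: HI].
Qed.

(** The triangular system is solved letter by letter. The first letter of a word belongs to the
    outermost integral, which is the order of [iter_int_rev]. *)
Lemma is_solution_iter_int a : 0 < T -> path_space T a ->
  is_solution T a (fun x w => iter_int_rev a w x).
Proof.
move=> T0 [aL _]; apply/is_solutionP; split=> //.
  apply/funext => -[|i w]//=.
  by rewrite cintegral_set0.
elim=> [|i w IH].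
  by under [X in cprim _ _ X]eq_fun do rewrite velocityM_nil; exact: cprim_cst.
apply: cprim_eq (cprim_cintegral T0 (aL i) IH) => x _.
by rewrite velocityM_cons.
Qed.

Lemma is_solution_uniq a F G : is_solution T a F -> is_solution T a G ->
  forall x, 0 <= x <= T -> F x = G x.
Proof.
move=> /is_solutionP[_ F0 pF] /is_solutionP[_ G0 pG] x xT.
apply/eqP; rewrite -subr_eq0; apply/eqP.
apply: (@linear_ode_zero a (fun x => F x - G x)) => //; first by rewrite F0 G0 subrr.
by apply: cpath_eq (cpathB pF pG) => y _; rewrite mulrBr.
Qed.

Lemma flow_solution a : 0 < T -> path_space T a -> is_solution T a (flow T a).
Proof.
by move=> T0 aX; apply: xgetPex; exists (fun x w => iter_int_rev a w x); exact: is_solution_iter_int.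
Qed.

(** By uniqueness the choice made in [flow] does not matter, and any explicit solution computes the
    holonomy. *)
Lemma holonomyE a F : 0 < T -> path_space T a -> is_solution T a F -> holonomy T a = F T.
Proof.
move=> T0 aX aF; apply: is_solution_uniq aF _ _; first exact: flow_solution.
by rewrite lexx ltW.
Qed.

Lemma holonomy_iter_int a w : 0 < T -> path_space T a ->
  holonomy T a w = iter_int_rev a w T.
Proof. by move=> T0 aX; rewrite (holonomyE T0 aX (is_solution_iter_int T0 aX)). Qed.

Lemma holonomy_unital a : 0 < T -> path_space T a -> holonomy T a [::] = 1.
Proof. by move=> T0 aX; rewrite holonomy_iter_int. Qed.

Lemma holonomy_dynkin a : 0 < T -> path_space T a -> dynkin_identity (holonomy T a).
Proof.
move=> T0 aX; have /is_solutionP[F1 F0 pF] := flow_solution T0 aX.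
rewrite /holonomy; move: (flow T a) F1 F0 pF => F F1 F0 pF.
apply/eqP; rewrite -subr_eq0; apply/eqP.
apply: (@linear_ode_zero a (fun x => dynkin (F x) * F x - euler (F x))).
- by rewrite F0 dynkin1 euler1 mul0r subrr.
- have pd := cpath_filtered (@filtered_dynkin R) pF.
  have pe := cpath_filtered (@filtered_euler R) pF.
  apply: cpath_eq (cpathB (cpathM pd pF) pe) => x /andP[x0 xT].
  have vl : letter_part (velocity a x) = velocity a x.
    by apply/funext => -[|i [|j w]].
  rewrite eulerM -{1}vl dynkin_letterM F1 ?ltW// scale1r vl.
  exact: (@dynkin_ode_identity R[i] (ncseries R)).
- by rewrite lexx ltW.
Qed.

Lemma holonomy_letters a w : 0 < T -> path_space2 T a ->
  has (fun i : posnat => (2 < val i)%N) w -> holonomy T a w = 0.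
Proof.
move=> T0 [aX a2] w2; have /is_solutionP[F1 F0 pF] := flow_solution T0 aX.
suff H x : 0 <= x <= T -> flow T a x w = 0 by apply: H; rewrite lexx ltW.
elim: w w2 x => [//|i w IH] w2 x xT.
have : cprim T (fun x => flow T a x (i :: w)) (fun=> 0).
  have := pF (i :: w); apply: cprim_ae_eq.
  have [i2|i2] := boolP (2 < val i)%N.
    apply: aeS (a2 i i2) => y H /andP[y0 yT].
    by rewrite velocityM_cons H ?mul0r//= in_itv/= !ltW.
  apply: aeW => y /andP[y0 yT]; rewrite velocityM_cons IH ?mulr0//.
    by move: w2; rewrite /= (negbTE i2).
  by rewrite !ltW.
by move=> /cprim_const ->//; rewrite F0.
Qed.

End Solutions.

(** * Holonomies of piecewise constant paths *)

Section StepPaths.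
Variable R : realType.
Local Notation A := (ncseries R).
Local Notation mu := (@lebesgue_measure R).
Local Notation normc := Normc.normc.
Implicit Types (a : posnat -> R -> R[i]) (F G : R -> A) (x y S T : R).

Lemma ae_neq S : {ae mu, forall x, x != S}.
Proof.
exists [set S]; split; [exact: measurable_set1|exact: lebesgue_measure_set1|].
by move=> x /= /negP; rewrite negbK => /eqP.
Qed.

(** Across S the Lipschitz estimate goes through the common value at S. Differentiability may fail
    at S itself, a single point and hence negligible. *)
Lemma rprim_glue S T (f f' g g' : R -> R) : 0 <= S -> S <= T ->
  rprim S f f' -> rprim T g g' -> f S = g S ->
  rprim T (fun x => if x <= S then f x else g x) (fun x => if x <= S then f' x else g' x).
Proof.
move=> S0 ST [[L Lf] df] [[M Mg] dg] fg; split.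
  have lip x y : 0 <= x -> x <= y -> y <= T ->
      `|(if y <= S then f y else g y) - (if x <= S then f x else g x)| <=
      (`|L| + `|M|) * (y - x).
    move=> x0 xy yT.
    have Lf' u v : 0 <= u -> u <= v -> v <= S -> `|f v - f u| <= `|L| * (v - u).
      move=> u0 uv vS; rewrite -(ger0_norm (x := v - u)) ?subr_ge0//.
      rewrite (@le_trans _ _ (L * `|v - u|)) ?Lf ?ler_wpM2r ?ler_norm//; lra.
    have Mg' u v : 0 <= u -> u <= v -> v <= T -> `|g v - g u| <= `|M| * (v - u).
      move=> u0 uv vS; rewrite -(ger0_norm (x := v - u)) ?subr_ge0//.
      rewrite (@le_trans _ _ (M * `|v - u|)) ?Mg ?ler_wpM2r ?ler_norm//; lra.
    have nL : 0 <= `|L| by []; have nM : 0 <= `|M| by [].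
    have xy0 : 0 <= y - x by lra.
    have aL : 0 <= `|L| * (y - x) by exact: mulr_ge0.
    have aM : 0 <= `|M| * (y - x) by exact: mulr_ge0.
    rewrite mulrDl; case: (leP y S) => yS; case: (leP x S) => xS; try lra.
    - by rewrite (le_trans (Lf' _ _ x0 xy yS))// lerDl.
    - rewrite -(subrK (g S) (g y)) -addrA -{2}fg (le_trans (ler_normD _ _))// [leRHS]addrC lerD//; last first.
        by apply: le_trans (Lf' _ _ x0 xS (lexx _)) _; rewrite ler_wpM2l//; lra.
      by apply: le_trans (Mg' _ _ S0 (ltW yS) yT) _; rewrite ler_wpM2l//; lra.
    - by rewrite (le_trans (Mg' _ _ x0 xy yT))// lerDr.
  exists (`|L| + `|M|) => x y /andP[x0 xT] /andP[y0 yT].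
  have [xy|yx] := leP x y.
    by rewrite distrC (distrC x) (ger0_norm (x := y - x)) ?subr_ge0//; exact: lip.
  by rewrite (gtr0_norm (x := x - y)) ?subr_gt0//; apply: lip => //; exact: ltW.
apply: aeS (aeI (aeI df dg) (ae_neq S)) => x [[dfx dgx] xS] /andP[x0 xT].
move: xS; rewrite neq_lt => /orP[xS|Sx].
  rewrite (ltW xS); apply: near_eq_is_derive (dfx _); last by rewrite x0.
  near=> y; rewrite ifT//; apply/ltW; near: y; exact: lt_nbhsl.
rewrite leNgt Sx/=; apply: near_eq_is_derive (dgx _); last by rewrite x0.
near=> y; rewrite leNgt ifF//; apply/negbTE; rewrite negbK; near: y; exact: lt_nbhsr.
Unshelve. all: by end_near. Qed.

Lemma cprim_glue S T (u u' v v' : R -> R[i]) : 0 <= S -> S <= T ->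
  cprim S u u' -> cprim T v v' -> u S = v S ->
  cprim T (fun x => if x <= S then u x else v x) (fun x => if x <= S then u' x else v' x).
Proof.
move=> S0 ST [Ru Iu] [Rv Iv] uv.
have E (P : R[i] -> R) (p q : R -> R[i]) :
  (fun x => P (if x <= S then p x else q x)) = (fun x => if x <= S then P (p x) else P (q x)).
  by apply/funext => x; case: ifP.
by split; rewrite !E; apply: rprim_glue => //; rewrite uv.
Qed.

Lemma cprim_linear T S c : cprim T (fun x => (x - S)%:C * c) (fun=> c).
Proof.
have -> : (fun x => (x - S)%:C * c) = (fun x => c * (x - S)%:C) by apply/funext => x; rewrite mulrC.
apply: cprim_eq (cprimZ c (u' := fun=> 1) _) => [x _|]; first by rewrite mulr1.
split=> /=.
  split.
    by exists 1 => x y _ _; rewrite mul1r opprB addrA subrK.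
  apply: aeW => x _.
  have := is_deriveB (is_derive_id x (1 : R)) (is_derive_cst S x (1 : R)).
  by rewrite subr0.
exact: rprim_cst.
Qed.

Lemma cpath_ncexp T z z' (f : A) : f [::] = 0 -> cprim T z z' ->
  cpath T (fun x => ncexp (z x *: f)) (fun x => z' x *: (f * ncexp (z x *: f))).
Proof.
move=> f0 pz w; pose N := (weight w).+1.
have zf0 x : (z x *: f) [::] = 0 by rewrite ncscaleE f0 mulr0.
have E x : ncexp (z x *: f) w = \sum_(k < N) ((k`!)%:R^-1 * (f ^+ k) w) * z x ^+ k :> R[i].
  rewrite (@ncexpE _ N)// /expsum ncsumE; apply: eq_bigr => k _.
  by rewrite ncscaleE exprZn ncscaleE -mulrA; congr (_ * _); exact: mulrC.
under eq_fun do rewrite E.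
rewrite /N; under eq_fun do rewrite big_ord_recl/= expr0 fact0 invr1 mulr1 mul1r.
have pk k := cprimZ ((bump 0 k)`!%:R^-1 * (f ^+ (bump 0 k)) w) (cprimX k pz).
have := cprim_sum (index_enum 'I_(weight w)) (fun k : 'I_(weight w) => pk k).
move=> /(cprimD (cprim_cst T ((1 : A) w))).
apply: cprim_eq => x _; rewrite add0r ncscaleE.
(* The factor f raises the order by one, so a partial sum one term shorter than for [ncexp]
   suffices; this matches the loss of one power under differentiation. *)
have -> : (f * ncexp (z x *: f)) w = (f * expsum (weight w) (z x *: f)) w.
  have : order_ge N (f * (ncexp (z x *: f) - expsum (weight w) (z x *: f))).
    rewrite /N -add1n; apply: order_geM; first exact/order_ge1P.
    exact: order_ge_ncexp.
  move=> /(_ w (leqnn _)); rewrite mulrBr ncaddE ncoppE => /eqP.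
  by rewrite subr_eq0 => /eqP.
rewrite mul_expsum ncsumE mulr_sumr; apply: eq_bigr => k _.
rewrite /bump/= add1n ncscaleE factS natrM.
have : k.+1%:R != 0 :> R[i] by rewrite pnatr_eq0.
have : k`!%:R != 0 :> R[i] by rewrite pnatr_eq0 -lt0n fact_gt0.
move: (k.+1%:R : R[i]) (k`!%:R : R[i]) ((f ^+ k.+1) w : R[i]) (z x ^+ k) (z' x).
move=> p q r s t q0 p0; rewrite /GRing.regular in r *.
by field; rewrite p0 q0.
Qed.

End StepPaths.

Section StepPathExistence.
Variable R : realType.
Local Notation A := (ncseries R).
Local Notation mu := (@lebesgue_measure R).
Local Notation normc := Normc.normc.
Implicit Types (a : posnat -> R -> R[i]) (x y S T : R).

Lemma Linfty_cst T c : Linfty T (fun=> c : R[i]).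
Proof.
by split; [exact: measurable_cst|exact: measurable_cst|exists (normc c); apply: aeW].
Qed.

Lemma Linfty_glue S T (f g : R -> R[i]) : Linfty S f -> Linfty T g ->
  Linfty T (fun x => if x <= S then f x else g x).
Proof.
move=> [mRf mIf [M fM]] [mRg mIg [N gN]].
have mle : measurable_fun `[0, T]%classic (fun x : R => x <= S).
  by apply: measurable_fun_ler => //; exact: measurable_cst.
have mglue (p q : R -> R) : measurable_fun `[0, S]%classic p -> measurable_fun `[0, T]%classic q ->
    measurable_fun `[0, T]%classic (fun x => if x <= S then p x else q x).
  move=> mp mq; apply: measurable_fun_if => //.
    apply: (measurable_funS _ _ mp) => //.
    by move=> x [] /=; rewrite !in_itv/= => /andP[-> _] ->.
  by apply: (measurable_funS _ _ mq) => // x [].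
split.
- rewrite (_ : (fun _ => _) = (fun x => if x <= S then complex.Re (f x) else complex.Re (g x))).
    exact: mglue.
  by apply/funext => x; case: ifP.
- rewrite (_ : (fun _ => _) = (fun x => if x <= S then complex.Im (f x) else complex.Im (g x))).
    exact: mglue.
  by apply/funext => x; case: ifP.
exists (Num.max M N); apply: aeS (aeI fM gN) => x [Hf Hg] xT.
case: ifP => xS; rewrite le_max ?Hg ?orbT//.
by rewrite Hf//=; move: xT; rewrite /= !in_itv/= xS => /andP[->].
Qed.

Lemma path_space_glue S T a b : path_space S a -> path_space T b ->
  path_space T (fun i x => if x <= S then a i x else b i x).
Proof.
move=> [aL [M aM]] [bL [N bN]]; split=> [i|]; first exact: Linfty_glue.
exists (Num.max M N) => i; apply: aeS (aeI (aM i) (bN i)) => x [Hf Hg] xT.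
case: ifP => xS; rewrite le_max ?Hg ?orbT//.
by rewrite Hf//=; move: xT; rewrite /= !in_itv/= xS => /andP[->].
Qed.

Definition letter_path (p : posnat) (c : R[i]) : posnat -> R -> R[i] :=
  fun i _ => if i == p then c else 0.

Lemma path_space_letter T p c : path_space T (letter_path p c).
Proof.
split=> [i|]; first exact: Linfty_cst.
exists (normc c `^ (val p)%:R^-1) => i; apply: aeW => x _; rewrite /letter_path.
case: eqP => [->//|_]; rewrite Normc.normc0 powR0 ?powR_ge0//.
by rewrite invr_eq0 pnatr_eq0 -lt0n (valP i).
Qed.

Lemma velocity_letter p c x : velocity (letter_path p c) x = c *: mono R [:: p].
Proof.
apply/funext => -[|i [|j w]]; rewrite ncscaleE /mono/= ?mulr0//.
  rewrite /letter_path eqseq_cons andbT; case: eqP; rewrite ?mulr1 ?mulr0//.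
by rewrite eqseq_cons andbF mulr0.
Qed.

(** Solutions grow by multiplication on the left, so the head of the list is the last factor in
    time. The tail is run on [0, T/2] by induction over all T, and the head on the rest at speed c /
    (T - S). *)
Lemma exists_step_path (s : seq (posnat * R[i])) T : 0 < T ->
  exists a, [/\ path_space T a,
    all (fun p => (val p.1 <= 2)%N) s -> forall i : posnat, (2 < val i)%N -> forall x, a i x = 0 &
    exists2 F, is_solution T a F &
      F T = \prod_(p <- s) ncexp (p.2 *: mono R [:: p.1])].
Proof.
elim: s T => [|[p c] s IH] T T0.
  exists (fun _ _ => 0); split=> //.
    split=> [i|]; first exact: Linfty_cst.
    exists 0 => i; apply: aeW => x _; rewrite Normc.normc0 powR0//.
    by rewrite invr_eq0 pnatr_eq0 -lt0n (valP i).
  exists (fun=> 1); last by rewrite big_nil.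
  apply/is_solutionP; split=> // w.
  apply: cprim_eq (cprim_cst T ((1 : A) w)) => x _.
  by case: w => [|i w]; rewrite ?velocityM_nil// velocityM_cons mul0r.
pose S := T / 2.
have S0 : 0 < S by rewrite divr_gt0.
have ST : S < T by rewrite /S; lra.
have [a [aX a2 [F aF FS]]] := IH S S0.
have /is_solutionP[F1 F0 pF] := aF.
pose d : R[i] := ((T - S)%:C)^-1 * c.
have TS : (T - S)%:C != 0 :> R[i] by rewrite fmorph_eq0 subr_eq0 gt_eqF.
pose z x : R[i] := (x - S)%:C * d.
pose G x : A := ncexp (z x *: mono R [:: p]) * F S.
have m0 : mono R [:: p] [::] = 0 by [].
have z0 x : (z x *: mono R [:: p]) [::] = 0 by rewrite ncscaleE m0 mulr0.
have GS : G S = F S by rewrite /G /z subrr mul0r scale0r ncexp0 mul1r.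
exists (fun i x => if x <= S then a i x else letter_path p d i x); split.
- by apply: path_space_glue => //; exact: path_space_letter.
- move=> /= /andP[p2 s2] i i2 x; rewrite a2// /letter_path.
  by case: eqP => [ip|_]; [move: p2; rewrite -ip leqNgt i2|case: ifP].
exists (fun x => if x <= S then F x else G x).
  apply/is_solutionP; split=> [x xT||w].
  - case: ifP => xS; first by apply: F1; move: xT; rewrite xS => /andP[->].
    by rewrite /G ncmul0 ncexp_nil// F1 ?mul1r// lexx ltW.
  - by rewrite ltW.
  have pG : cpath T G (fun x => velocity (letter_path p d) x * G x).
    have pz : cprim T z (fun=> d) by exact: cprim_linear.
    apply: cpath_eq (cpathM (cpath_ncexp m0 pz) (cpath_cst T (F S))) => x _.
    by rewrite mulr0 addr0 velocity_letter /G -!scalerAl mulrA.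
  have := cprim_glue (ltW S0) (ltW ST) (pF w) (pG w) _.
  rewrite GS => /(_ erefl).
  rewrite (_ : (fun x => if x <= S then F x w else G x w) =
    (fun x => (if x <= S then F x else G x) w)); last by apply/funext => x; case: ifP.
  apply: cprim_eq => x _; case: w => [|i w].
    by rewrite !velocityM_nil; case: ifP.
  by rewrite !velocityM_cons; case: ifP.
have zT : z T = c by rewrite /z /d mulrA divff ?mul1r.
by rewrite leNgt ST /G zT FS big_cons.
Qed.

End StepPathExistence.

(** * Formal vector fields *)

Section VectorFields.
Variable R : realType.
Local Notation A := (ncseries R).
Implicit Types (f g h : A) (u v w : word) (c : R[i]).

(* The coefficient of r^(m + weight v) in D_(v_k) .. D_(v_1) r^m, where
   D_i = r^(i+1) d/dr: words act from their first letter on. *)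
Fixpoint vf_coef (m : nat) v : R[i] :=
  if v is i :: v' then m%:R * vf_coef (m + val i) v' else 1.

Lemma vf_coef_cat m u v : vf_coef m (u ++ v) = vf_coef m u * vf_coef (m + weight u) v.
Proof.
elim: u m => [|i u IH] m /=; first by rewrite mul1r weight_nil addn0.
by rewrite IH weight_cons mulrA addnA.
Qed.

(** The matrix entry of [f] from r^m to r^(m+n). *)
Definition vf_action m n f : R[i] :=
  \sum_(v <- words_below n.+1 | weight v == n) vf_coef m v * f v.

Lemma vf_action_linear m n : linear (vf_action m n : A -> R[i]^o).
Proof.
move=> c f g; transitivity (c * vf_action m n f + vf_action m n g : R[i]); last by [].
rewrite /vf_action mulr_sumr -big_split/=; apply: eq_bigr => v _; rewrite ncaddE ncscaleE mulrDr; congr (_ + _).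
by rewrite mulrCA.
Qed.

Lemma vf_action_order m n f : order_ge n.+1 f -> vf_action m n f = 0.
Proof. by move=> fn; rewrite /vf_action big1// => v /eqP vn; rewrite fn ?mulr0// vn. Qed.

Lemma vf_action_mono m n v :
  vf_action m n (mono R v) = if weight v == n then vf_coef m v else 0.
Proof.
rewrite /vf_action; case: ifPn => [/eqP vn|vn].
  rewrite big_mkcond (bigD1_seq v) ?words_below_uniq ?mem_words_below ?vn//= eqxx.
  rewrite /mono eqxx mulr1 big1 ?addr0// => u uv.
  by rewrite (negbTE uv) mulr0 if_same.
rewrite big1// => u /eqP un; rewrite /mono; case: eqP => [uv|_]; last by rewrite mulr0.
by move: vn; rewrite -uv un eqxx.
Qed.

Lemma functional_eq N (L1 L2 : A -> R[i]^o) : linear L1 -> linear L2 ->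
  (forall g, order_ge N g -> L1 g = 0) -> (forall g, order_ge N g -> L2 g = 0) ->
  (forall v, L1 (mono R v) = L2 (mono R v)) -> forall f, L1 f = L2 f.
Proof.
move=> l1 l2 k1 k2 m12 f; rewrite (linmap_truncation l1 f k1) (linmap_truncation l2 f k2).
by apply: eq_bigr => v _; rewrite m12.
Qed.

(** Matrix multiplication with [f] acting before [g], since words act from their first letter on. By
    linearity it is checked on pairs of words. *)
Lemma vf_actionM m n f g : vf_action m n (f * g) =
  \sum_(k < n.+1) vf_action m k f * vf_action (m + k) (n - k) g.
Proof.
have lin := vf_action_linear.
apply: (@functional_eq n.+1 (fun f => vf_action m n (f * g) : R[i]^o)
  (fun f => \sum_(k < n.+1) vf_action m k f * vf_action (m + k) (n - k) g : R[i]^o)).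
- by move=> c h k; rewrite mulrDl -scalerAl lin.
- move=> c h k; transitivity (c * (\sum_(j < n.+1) vf_action m j h * vf_action (m + j) (n - j) g) +
    \sum_(j < n.+1) vf_action m j k * vf_action (m + j) (n - j) g : R[i]); last by [].
  rewrite mulr_sumr -big_split/=; apply: eq_bigr => j _.
  by rewrite lin mulrDl mulrA.
- move=> h hn; rewrite vf_action_order// -(addn0 n.+1); exact: order_geM.
- move=> h hn; rewrite big1// => k _; rewrite vf_action_order ?mul0r//.
  by apply: order_geW hn.
move=> u; apply: (@functional_eq n.+1 (fun g => vf_action m n (mono R u * g) : R[i]^o)
  (fun g => \sum_(k < n.+1) vf_action m k (mono R u) * vf_action (m + k) (n - k) g : R[i]^o)).
- by move=> c h k; rewrite mulrDr -scalerAr lin.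
- move=> c h k; transitivity (c * (\sum_(j < n.+1) vf_action m j (mono R u) * vf_action (m + j) (n - j) h) +
    \sum_(j < n.+1) vf_action m j (mono R u) * vf_action (m + j) (n - j) k : R[i]); last by [].
  rewrite mulr_sumr -big_split/=; apply: eq_bigr => j _.
  by rewrite lin mulrDr; congr (_ + _); exact: mulrCA.
- move=> h hn; rewrite vf_action_order// -(add0n n.+1); exact: order_geM.
- move=> h hn; rewrite big1// => k _; rewrite [X in _ * X]vf_action_order ?mulr0//.
  by apply: order_geW hn; rewrite ltnS leq_subr.
move=> v; rewrite -mono_cat vf_action_mono weight_cat.
have [un|un] := leqP (weight u) n.
  rewrite (bigD1 (Ordinal (leq_ltn_trans un (ltnSn n))))//= big1 ?addr0 => [|k ku].
    rewrite !vf_action_mono eqxx -[in X in _ = _ * X](eqn_add2l (weight u)) subnKC//.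
    by case: ifP; rewrite ?mulr0// vf_coef_cat.
  rewrite vf_action_mono; case: eqP => [uk|_]; last by rewrite mul0r.
  by case/eqP: ku; exact/val_inj.
rewrite gtn_eqF ?(leq_trans un) ?leq_addr// big1// => k _.
by rewrite vf_action_mono gtn_eqF ?mul0r// (leq_trans (ltn_ord k)).
Qed.

Definition vf_kernel : set A := [set f | forall m n, vf_action m n f = 0].

Lemma vf_kernelMl f g : vf_kernel f -> vf_kernel (f * g).
Proof. by move=> f0 m n; rewrite vf_actionM big1// => k _; rewrite f0 mul0r. Qed.

Lemma vf_kernelMr f g : vf_kernel g -> vf_kernel (f * g).
Proof. by move=> g0 m n; rewrite vf_actionM big1// => k _; rewrite g0 mulr0. Qed.

Lemma vf_kernel_linear c f g : vf_kernel f -> vf_kernel g -> vf_kernel (c *: f + g).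
Proof.
by move=> f0 g0 m n; have := vf_action_linear m n c f g; rewrite f0 g0 scaler0 addr0.
Qed.

Lemma vf_kernelB f g : vf_kernel f -> vf_kernel g -> vf_kernel (f - g).
Proof. by move=> f0 g0; rewrite addrC -scaleN1r; exact: vf_kernel_linear. Qed.

Lemma vf_kernel0 : vf_kernel 0.
Proof. by move=> m n; exact: (linmap0 (vf_action_linear m n)). Qed.

Lemma vf_kernel_closed : closed vf_kernel.
Proof.
have -> : vf_kernel = \bigcap_(mn in [set: nat * nat])
    ((fun f : A => vf_action mn.1 mn.2 f : R[i]^o) @^-1` [set 0]).
  rewrite eqEsubset; split=> f f0; first by move=> mn _; exact: f0.
  by move=> m n; exact: (f0 (m, n)).
apply: closed_bigI => mn _; apply: closed_comp => [f _|].
  rewrite /vf_action; under eq_fun do rewrite big_mkcond.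
  apply: (@cvg_sumK R[i] _ _ (nbhs_filter f)) => v.
  case: ifP => _; last exact: (@cvg_cstK R[i] _ _ (nbhs_filter f)).
  apply: (@cvgMK R[i] _ _ (nbhs_filter f)); last exact: coef_continuous.
  exact: (@cvg_cstK R[i] _ _ (nbhs_filter f)).
exact: (accessible_closed_set1 (hausdorff_accessible (@norm_hausdorff _ R[i]^o))).
Qed.

(** The origin of the factor 1 / (i - 2): X_(i-1) X_1 and X_1 X_(i-1) send r^m to m (m + i - 1)
    r^(m+i) and m (m + 1) r^(m+i), and the difference is i - 2 times the action of X_i. *)
Lemma vf_kernel_s_elt i : (3 <= i)%N -> vf_kernel (s_elt R i).
Proof.
case: i => [|[|[|j]]]// _ m n.
pose p (k : nat) : posnat := exist (fun i => (0 < i)%N) k.+1 isT.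
have gp k : gen R k.+1 = mono R [:: p k] by exact: (gen_mono R (p k)).
rewrite /s_elt /lie !gp -!mono_cat.
have lin := vf_action_linear m n.
rewrite (linmapB lin) (linmapZ lin) (linmapB lin) !vf_action_mono.
rewrite !weight_cons weight_nil /= !addn0 addn1 add1n.
case: eqP => _; last by rewrite subrr scaler0 subr0.
rewrite !mulr1 /=; have j0 : (j.+1%:R : R[i]) != 0 by rewrite pnatr_eq0.
rewrite /GRing.scale/= !natrD -[j.+3%:R]natr1 -[j.+2%:R]natr1.
by rewrite [X in X^-1](_ : _ = j.+1%:R :> R[i]); [field|ring].
Qed.

Lemma calN_vf_kernel : calN R `<=` vf_kernel.
Proof.
move=> f Nf; suff : (lie_elements R `&` vf_kernel) f by case.
have [L0 LD LL] := lie_elements_subalgebra R.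
move: f Nf; apply: smallest_sub; last first.
  by move=> _ [i i3 <-]; split; [exact: s_elt_lie|exact: vf_kernel_s_elt].
split; first by move=> f [].
- split; first by split=> //; exact: vf_kernel0.
    by move=> c f g [Lf f0] [Lg g0]; split; [exact: LD|exact: vf_kernel_linear].
  move=> f g [Lf f0] [Lg g0]; split; first exact: LL.
  by apply: vf_kernelB; [exact: vf_kernelMl|exact: vf_kernelMr].
- move=> f h Lf [Lh h0]; split; first exact: LL.
  by apply: vf_kernelB; [exact: vf_kernelMr|exact: vf_kernelMl].
- move=> f [Lf cf]; split=> //; apply: vf_kernel_closed.
  by move: f cf {Lf}; apply: closure_subset => f [].
Qed.

Lemma vf_action_exp m n f : f [::] = 0 -> vf_kernel f ->
  vf_action m n (ncexp f) = (n == 0%N)%:R.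
Proof.
move=> f0 kf; have lin := vf_action_linear m n.
have -> : vf_action m n (ncexp f) = vf_action m n (expsum n.+1 f).
  rewrite -[ncexp f](subrK (expsum n.+1 f)) (linmapD lin).
  by rewrite [X in X + _]vf_action_order ?add0r//; exact: order_ge_ncexp.
rewrite /expsum (linmap_sum lin) big_ord_recl big1 ?addr0 => [|k _].
  rewrite expr0 fact0 invr1 scale1r -mono_nil vf_action_mono weight_nil eq_sym.
  by case: ifP.
by rewrite exprS (linmapZ lin) [vf_action _ _ _](vf_kernelMl _ kf) scaler0.
Qed.

(** At t = i_1 + .. + i_k the factor t - i_1 - .. - i_j + 1 is 1 plus the weight of the remaining
    letters. This is the exponent reached from r^1 once those letters have acted, last letter first;
    hence the reversal and m = 1. *)
Lemma center_poly_eval w :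
  (center_poly R w).[(weight w)%:R] = vf_coef 1 (rev w).
Proof.
suff H t r : t = (weight w + r)%N -> (center_poly R w).[t%:R] = vf_coef r.+1 (rev w).
  by rewrite (H _ 0%N)// addn0.
rewrite /center_poly horner_prod; elim: w t r => [|i w IH] t r tE.
  by rewrite big_ord0.
rewrite big_ord_recl rev_cons -cats1 vf_coef_cat /= mulr1 mulrC.
have ti : (t - val i)%N = (weight w + r)%N by rewrite tE weight_cons -addnA addKn.
rewrite -(IH _ _ ti); congr (_ * _).
  apply: eq_bigr => j _; rewrite !hornerE /= weight_cons.
  rewrite /bump/= add1n natrD natrB ?opprD ?addrA//.
  by rewrite tE weight_cons -addnA leq_addr.
rewrite !hornerE take0 weight_cons weight_nil addn0 weight_rev.
rewrite tE weight_cons -addnA natrD [_ - _]addrAC subrr add0r.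
by rewrite addSn addnC natr1.
Qed.

End VectorFields.

(** * The group of formal paths *)

Lemma closure_sub_closed (X : topologicalType) (S B : set X) :
  closed B -> S `<=` B -> closure S `<=` B.
Proof. by move=> Bc SB x cx; apply: Bc; exact: closure_subset cx. Qed.

Section FormalPaths.
Variables (R : realType) (T : R).
Hypothesis T_gt0 : 0 < T.
Local Notation A := (ncseries R).
Implicit Types (f g h : A) (u v w : word) (c : R[i]).

Lemma closure_mul (P : set A) : (forall f g, P f -> P g -> P (f * g)) ->
  forall f g, closure P f -> closure P g -> closure P (f * g).
Proof.
move=> PM f g.
have fid := @filtered_id R.
have right h : P h -> forall k, closure P k -> closure P (k * h).
  move=> Ph; suff: closure P `<=` [set k | closure P (k * h)] by exact.
  apply: (@closure_sub_closed _ P) => [|k Pk]; last by apply: subset_closure; exact: PM.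
  rewrite (_ : mkset _ = (fun k => k * h) @^-1` closure P)//.
  apply: closed_comp => [k _|]; last exact: closed_closure.
  exact: (filtered_continuous (filteredMr h fid)).
move=> Pf; suff: closure P `<=` [set k | closure P (f * k)] by exact.
apply: closure_sub_closed => [|k Pk]; last exact: right.
rewrite (_ : mkset _ = (fun k => f * k) @^-1` closure P)//.
apply: closed_comp => [k _|]; last exact: closed_closure.
exact: (filtered_continuous (filteredMl f fid)).
Qed.

Lemma closed_unital : closed (unital_series R).
Proof.
have -> : unital_series R = (fun f : A => f [::] : R[i]^o) @^-1` [set 1] by [].
apply: closed_comp => [f _|]; first exact: coef_continuous.
exact: (accessible_closed_set1 (hausdorff_accessible (@norm_hausdorff _ R[i]^o))).
Qed.

(** The predicate selects the letters: all of them for the group of formal paths, those at most 2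
    for formal paths in the plane. *)
Definition steps (Q : pred posnat) : set A :=
  [set g | exists2 s : seq (posnat * R[i]), all (Q \o fst) s &
    g = \prod_(p <- s) ncexp (p.2 *: mono R [:: p.1])].

Lemma steps1 Q : steps Q 1.
Proof. by exists [::]; rewrite ?big_nil. Qed.

Lemma stepsM Q f g : steps Q f -> steps Q g -> steps Q (f * g).
Proof.
move=> [s Qs ->] [t Qt ->]; exists (s ++ t); last by rewrite big_cat.
by rewrite all_cat Qs.
Qed.

Let C Q := closure (steps Q).

Let C_closed Q : closed (C Q). Proof. exact: closed_closure. Qed.
Let C1 Q : C Q 1. Proof. by apply: subset_closure; exact: steps1. Qed.
Let CM Q f g : C Q f -> C Q g -> C Q (f * g).
Proof. by apply: closure_mul; exact: stepsM. Qed.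

Let C_gen (Q : pred posnat) (p : posnat) : Q p -> explie (C Q) (gen R (val p)).
Proof.
move=> Qp; rewrite gen_mono; split=> // c; apply: subset_closure.
by exists [:: (p, c)]; rewrite /= ?Qp// big_seq1.
Qed.

Let gen_posnat i : (1 <= i)%N -> exists2 p : posnat, val p = i & gen R i = gen R (val p).
Proof. by move=> i1; exists (exist (fun i => (0 < i)%N) i i1). Qed.

Let le2 : pred posnat := fun p => (val p <= 2)%N.

Lemma lie_elements_steps : lie_elements R `<=` explie (closure (steps predT)).
Proof.
have LC : lie_subalgebra (explie (C predT)).
  by apply: explie_subalgebra; [exact: C_closed|exact: C1|exact: CM].
apply: (lie_elements_closed_sub LC); first exact: (explie_closed (@C_closed predT)).
by move=> i /gen_posnat[p _ ->]; exact: (@C_gen predT).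
Qed.

Lemma retract_steps f : lie_elements R f -> explie (closure (steps le2)) (retract f).
Proof.
have LC : lie_subalgebra (explie (C le2)).
  by apply: explie_subalgebra; [exact: C_closed|exact: C1|exact: CM].
suff : lie_elements R `<=` [set f | explie (C le2) (retract f)] by exact.
apply: lie_elements_closed_sub; first exact: (retract_subalgebra LC).
  rewrite (_ : mkset _ = @retract R @^-1` explie (C le2))//.
  apply: closed_comp => [g _|].
    by apply: filtered_continuous; exact: filtered_retract.
  exact: (explie_closed (@C_closed le2)).
move=> i _ /=; rewrite retract_gen.
have sub : free_lie (R := R) 2 `<=` explie (C le2).
  apply: free_lie_sub => // j /andP[/gen_posnat[p pj ->] j2].
  by apply: C_gen; rewrite /le2 pj.
by apply: sub; exact: retr_gen_free_lie.
Qed.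

Local Notation K := (formal_paths T).
Local Notation H := (formal_paths2 T).
Local Notation N := (@ncexp R @` calN R).

Lemma steps_holonomy : steps predT `<=` @holonomy R T @` path_space T.
Proof.
move=> _ [s _ ->]; have [a [aX _ [F aF <-]]] := exists_step_path s T_gt0.
by exists a => //; exact: holonomyE.
Qed.

Lemma steps_holonomy2 : steps le2 `<=` @holonomy R T @` path_space2 T.
Proof.
move=> _ [s s2 ->]; have [a [aX a2 [F aF <-]]] := exists_step_path s T_gt0.
exists a; last exact: holonomyE.
by split=> // i i2; apply: aeW => x _; exact: a2.
Qed.

Lemma holonomy_sub_unital : @holonomy R T @` path_space T `<=` unital_series R.
Proof. by move=> _ [a aX <-]; exact: holonomy_unital. Qed.

Lemma formal_pathsE : K = closure (@holonomy R T @` path_space T).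
Proof.
rewrite /formal_paths; apply/setIidr.
exact: (closure_sub_closed closed_unital holonomy_sub_unital).
Qed.

Lemma steps_formal_paths : closure (steps predT) `<=` K.
Proof. by rewrite formal_pathsE; apply: closure_subset; exact: steps_holonomy. Qed.

Lemma steps_formal_paths2 : closure (steps le2) `<=` H.
Proof.
move=> g Cg; split; last by move: g Cg; apply: closure_subset; exact: steps_holonomy2.
apply: steps_formal_paths; move: g Cg; apply: closure_subset => _ [s _ ->].
by exists s => //; apply/allP.
Qed.

Lemma exp_formal_paths f : lie_elements R f -> K (ncexp f).
Proof.
move=> /lie_elements_steps[_ Cf]; apply: steps_formal_paths.
by rewrite -[f]scale1r.
Qed.

Lemma formal_paths_unital g : K g -> g [::] = 1.
Proof. by case. Qed.

Lemma formal_paths_dynkin g : K g -> dynkin_identity g.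
Proof.
rewrite formal_pathsE; suff : closure (@holonomy R T @` path_space T) `<=`
  [set g | dynkin_identity g] by exact.
apply: closure_sub_closed; first exact: dynkin_identity_closed.
by move=> _ [a aX <-]; exact: holonomy_dynkin.
Qed.

Lemma formal_paths_exp g : K g <-> exists2 f, lie_elements R f & ncexp f = g.
Proof.
split=> [Kg|[f Lf <-]]; last exact: exp_formal_paths.
apply: log_lie_elements; [exact: formal_paths_unital|exact: formal_paths_dynkin|].
by move=> f Lf; apply: formal_paths_dynkin; exact: exp_formal_paths.
Qed.

Lemma formal_paths_closed : closed K.
Proof. by rewrite formal_pathsE; exact: closed_closure. Qed.

Lemma formal_paths1 : K 1.
Proof. by apply: steps_formal_paths; exact: C1. Qed.

(** Every element of K is the exponential of a Lie series, hence a limit of products in [steps], and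
    these are stable under multiplication. No concatenation of general paths is involved. *)
Lemma formal_pathsM g h : K g -> K h -> K (g * h).
Proof.
have KC k : K k -> C predT k.
  move=> /formal_paths_exp[f /lie_elements_steps[_ Cf] <-].
  by rewrite -[f]scale1r; exact: Cf.
by move=> /KC Cg /KC Ch; apply: steps_formal_paths; exact: CM.
Qed.

Lemma formal_pathsV g : K g -> K g^-1.
Proof.
move=> /formal_paths_exp[f Lf <-]; have [f0 _] := Lf; rewrite ncexpV//.
apply: exp_formal_paths; have [_ _ LZ _] := lie_subalgebraP (lie_elements_subalgebra R).
by rewrite -scaleN1r; exact: LZ.
Qed.

(** * Kernel and image of the retraction on formal paths *)

Lemma exp_calNE g : N g <-> K g /\ retract g = 1.
Proof.
have [NL _ _ _] := calN_ideal R.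
split=> [[f Nf <-]|[/formal_paths_exp[f Lf <-] rg]].
  have Lf := NL _ Nf; have [f0 _] := Lf; split; first exact: exp_formal_paths.
  by rewrite retract_exp// calN_retract// ncexp0.
have [f0 _] := Lf; exists f => //.
have rf : retract f = 0.
  apply: ncexp_inj => //; first exact: retract_aug.
  by rewrite -retract_exp// rg ncexp0.
by have := calN_sub_retract Lf; rewrite rf subr0.
Qed.

Lemma formal_paths_retract g : K g -> H (retract g).
Proof.
move=> /formal_paths_exp[f Lf <-]; have [f0 _] := Lf; rewrite retract_exp//.
apply: steps_formal_paths2; have [_ Cf] := retract_steps Lf.
by rewrite -[retract f]scale1r.
Qed.

Lemma formal_paths2E g : H g <-> K g /\ retract g = g.
Proof.
split=> [[Kg Hg]|[Kg <-]]; last exact: formal_paths_retract.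
split=> //; suff : closure (@holonomy R T @` path_space2 T) `<=` [set g | retract g = g] by exact.
apply: closure_sub_closed => [|_ [a aX <-]]; last first.
  by apply: retract_id => v v2; exact: holonomy_letters v2.
rewrite (_ : mkset _ = (fun f => retract f - f) @^-1` [set 0]); last first.
  rewrite eqEsubset; split=> f /= => [->|/eqP]; first by rewrite subrr.
  by rewrite subr_eq0 => /eqP.
apply: closed_comp => [f _|].
  apply: (@filtered_continuous _ (fun f => retract f - f)).
  by apply: filteredB; [exact: filtered_retract|exact: filtered_id].
exact: (accessible_closed_set1 (hausdorff_accessible (@ncseries_hausdorff R))).
Qed.

Lemma retractV g : g [::] = 1 -> retract g^-1 = (retract g)^-1.
Proof.
move=> g1; have [gV _] := unital_inv g1; apply/esym/unital_inv_uniq.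
  exact: retract_unital.
by rewrite -retractM gV retract1.
Qed.

Lemma formal_paths_subgroup : subgroup_of (unital_series R) K.
Proof.
split; [by move=> g []|exact: formal_paths1|exact: formal_pathsM|exact: formal_pathsV].
Qed.

Lemma exp_calN_normal : normal_subgroup_of K N.
Proof.
split; first split.
- by move=> g /exp_calNE[].
- by apply/exp_calNE; split; [exact: formal_paths1|exact: retract1].
- move=> f g /exp_calNE[Kf rf] /exp_calNE[Kg rg]; apply/exp_calNE.
  by split; [exact: formal_pathsM|rewrite retractM rf rg mulr1].
- move=> f /exp_calNE[Kf rf]; apply/exp_calNE; split; first exact: formal_pathsV.
  by rewrite retractV ?rf ?invr1//; exact: formal_paths_unital.
move=> g h Kg /exp_calNE[Kh rh]; apply/exp_calNE; split.
  by apply: formal_pathsM; [exact: formal_pathsM|exact: formal_pathsV].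
rewrite !retractM rh mulr1 -retractM.
by have [-> _] := unital_inv (formal_paths_unital Kg); exact: retract1.
Qed.

Lemma formal_paths2_subgroup : subgroup_of K H.
Proof.
split.
- by move=> g /formal_paths2E[].
- by apply/formal_paths2E; split; [exact: formal_paths1|exact: retract1].
- move=> f g /formal_paths2E[Kf rf] /formal_paths2E[Kg rg]; apply/formal_paths2E.
  by split; [exact: formal_pathsM|rewrite retractM rf rg].
- move=> f /formal_paths2E[Kf rf]; apply/formal_paths2E; split; first exact: formal_pathsV.
  by rewrite retractV ?rf//; exact: formal_paths_unital.
Qed.

Lemma formal_paths_semidirect : semidirect_product K N H.
Proof.
split; [exact: formal_paths_subgroup|exact: exp_calN_normal|exact: formal_paths2_subgroup| |].
  rewrite eqEsubset; split=> [g [/exp_calNE[_ rg] /formal_paths2E[_ rg']]|_ ->].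
    by rewrite /= -rg' rg.
  split; first by have [[_ N1 _ _] _] := exp_calN_normal.
  by have [_ H1 _ _] := formal_paths2_subgroup.
rewrite eqEsubset; split=> [g Kg|_ [n /exp_calNE[Kn _] [h /formal_paths2E[Kh _] <-]]]; last first.
  exact: formal_pathsM.
have Hr := formal_paths_retract Kg; have [Kr rr] := (formal_paths2E _).1 Hr.
exists (g * (retract g)^-1); last first.
  exists (retract g) => //; rewrite -mulrA.
  by have [_ ->] := unital_inv (formal_paths_unital Kr); rewrite mulr1.
apply/exp_calNE; split; first by apply: formal_pathsM => //; exact: formal_pathsV.
rewrite retractM retractV ?rr//; last exact: formal_paths_unital.
by have [-> _] := unital_inv (formal_paths_unital Kr).
Qed.

Lemma exp_calN_closed : K `&` closure N `<=` N.
Proof.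
move=> g [Kg cg]; apply/exp_calNE; split=> //.
suff : closure N `<=` [set g | retract g = 1] by exact.
apply: closure_sub_closed => [|f /exp_calNE[]//].
rewrite (_ : mkset _ = @retract R @^-1` [set 1])//; apply: closed_comp => [f _|].
  by apply: filtered_continuous; exact: filtered_retract.
exact: (accessible_closed_set1 (hausdorff_accessible (@ncseries_hausdorff R))).
Qed.

Lemma exp_s_elt i c : (3 <= i)%N -> N (ncexp (c *: s_elt R i)).
Proof.
move=> i3; exists (c *: s_elt R i) => //; have [_ Nalg _ _] := calN_ideal R.
by have [_ _ NZ _] := lie_subalgebraP Nalg; apply: NZ; exact: calN_s_elt.
Qed.

Lemma exp_calN_minimal (M : set A) : closed_normal_subgroup_of K M ->
  (forall i c, (3 <= i)%N -> M (ncexp (c *: s_elt R i))) -> N `<=` M.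
Proof.
move=> [[[MK M1 MM MV] Mn] Mc] Ms.
have Mcl : closed M.
  move=> g Mg; apply: Mc; split=> //; apply: formal_paths_closed.
  by move: g Mg; apply: closure_subset.
suff NM : calN R `<=` lie_elements R `&` explie M.
  by move=> _ [f /NM[_ [_ Mf]] <-]; rewrite -[f]scale1r.
have [L0 LD LL] := lie_elements_subalgebra R.
have [_ LB LZ _] := lie_subalgebraP (lie_elements_subalgebra R).
have [E0 ED EL] := explie_subalgebra Mcl M1 MM.
apply: smallest_sub; last first.
  move=> _ [i i3 <-]; split; first exact: s_elt_lie.
  by split=> [|c]; [have [] := s_elt_lie R i|exact: Ms].
split; first by move=> f [].
- split; first by split.
    by move=> c f g [Lf Ef] [Lg Eg]; split; [exact: LD|exact: ED].
  by move=> f g [Lf Ef] [Lg Eg]; split; [exact: LL|exact: EL].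
- move=> f h Lf [Lh Eh]; split; first exact: LL.
  (* Normality of [M] applies because exp(c f) lies in K for every Lie series f. *)
  apply: explie_lie => //; first by case: Lf.
  by move=> c g Mg; apply: Mn => //; apply: exp_formal_paths; exact: LZ.
- move=> f [Lf cf]; split=> //; apply: explie_closed => //.
  by move: f cf {Lf}; apply: closure_subset => f [].
Qed.

(** The coefficient at [rev w] is one continuous extension, and holonomies are dense in K, so the
    chosen one agrees with it there. *)
Lemma iter_int_hatE w g : K g -> iter_int_hat T w g = g (rev w).
Proof.
move=> Kg; rewrite /iter_int_hat; set S := mkset _.
have [hc hE] : S (xget (fun=> 0) S).
  apply: xgetPex; exists (fun g => g (rev w)); split.
    by apply: continuous_subspaceT; exact: coef_continuous.
  by move=> a aX; rewrite holonomy_iter_int.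
move: (xget _ S) hc hE => h hc hE.
pose D := @holonomy R T @` path_space T.
have DK : D `<=` K by move=> k Dk; rewrite formal_pathsE; exact: subset_closure.
have Dg : closure D g by rewrite -formal_pathsE.
(* Limits are compared along the holonomies near g, a proper filter because g lies in their
   closure. *)
have PF : ProperFilter (within D (nbhs g)) by exact: within_nbhs_proper.
have hg : h @ within D (nbhs g) --> (h g : R[i]^o).
  apply: (cvg_trans _ ((subspace_continuousP K h).1 hc g Kg)).
  apply: cvg_app => U; rewrite /within/= => KU.
  by apply: (@filterS _ (nbhs g) _ _ _ _ KU) => k UK Dk; apply: UK; exact: DK.
have cg : (fun k : A => k (rev w) : R[i]^o) @ within D (nbhs g) --> (g (rev w) : R[i]^o).
  by apply: (cvg_trans _ (@coef_continuous R (rev w) g)); apply: cvg_app; exact: cvg_within.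
apply: (cvg_unique (@norm_hausdorff _ R[i]^o) _ cg).
apply: cvg_trans hg; apply: near_eq_cvg; near=> k.
have [a aX <-] : D k by near: k; exact: withinT.
by rewrite hE// holonomy_iter_int.
Unshelve. all: by end_near.
Qed.

Lemma exp_calN_centers : N `<=` formal_centers T.
Proof.
move=> g Ng; have [Kg _] := (exp_calNE g).1 Ng; split=> //.
(* The first two coefficients agree by definition; coefficient n + 2 is a sum over words of weight n
   + 1. *)
apply/funext => -[|[|n]]//; rewrite /identity_series/=.
have memE w : (w \in [seq w <- words_below n.+2 | weight w == n.+1]) = (weight w == n.+1).
  by rewrite mem_filter mem_words_below; case: eqP => // ->; rewrite ltnSn.
have setE : [set w : word | weight w = n.+1] =
    [set` [seq w <- words_below n.+2 | weight w == n.+1]].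
  by apply/seteqP; split=> w /=; rewrite memE => /eqP.
have uq : uniq [seq w <- words_below n.+2 | weight w == n.+1].
  by rewrite filter_uniq// words_below_uniq.
rewrite setE -fsbig_seq// big_filter.
(* This coefficient is the matrix entry of g from r to r^(n+2), which vanishes because g = exp f
   with f acting as 0. *)
transitivity (vf_action 1 n.+1 g); last first.
  case: Ng => f Nf <-; have [NL _ _ _] := calN_ideal R; have [f0 _] := NL _ Nf.
  by rewrite vf_action_exp//; exact: calN_vf_kernel.
rewrite /vf_action -[RHS]big_filter.
(* Polynomial and iterated integral at w both turn into data at [rev w], and reversal permutes the
   words of a given weight. *)
transitivity (\sum_(w <- map rev [seq w <- words_below n.+2 | weight w == n.+1])
    vf_coef R 1 w * g w).
  rewrite big_map big_filter; apply: eq_bigr => w /eqP wn.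
  by rewrite iter_int_hatE//; have := center_poly_eval R w; rewrite wn => ->.
apply: perm_big; apply: uniq_perm => //; first by rewrite map_inj_uniq//; exact: can_inj revK.
move=> w; rewrite -[w in LHS]revK mem_map; last exact: can_inj revK.
by rewrite !mem_filter !mem_words_below weight_rev.
Qed.

End FormalPaths.

Theorem proposition3p9 (R : realType) (T : R) (T_gt0 : 0 < T) :
  [/\ semidirect_product (formal_paths T) (@ncexp R @` calN R)
        (formal_paths2 T),
      @ncexp R @` calN R `<=` formal_centers T,
      closed_normal_subgroup_of (formal_paths T) (@ncexp R @` calN R),
      (forall (i : nat) (c : R[i]), (3 <= i)%N ->
         (@ncexp R @` calN R) (ncexp (c *: s_elt R i))) &
      (forall H : set (ncseries R),
         closed_normal_subgroup_of (formal_paths T) H ->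
         (forall (i : nat) (c : R[i]), (3 <= i)%N ->
            H (ncexp (c *: s_elt R i))) ->
         @ncexp R @` calN R `<=` H)].
Proof.
split.
- exact: formal_paths_semidirect.
- exact: exp_calN_centers.
- by split; [exact: exp_calN_normal|exact: exp_calN_closed].
- by move=> i c; exact: exp_s_elt.
- by move=> H; exact: exp_calN_minimal.
Qed.
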